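(* Let $E=X_{\mathrm{AH}}\oplus\ell_\infty$. Then the set \[ \mathscr{K}_1=\left\{\begin{pmatrix} T_{1,1} & T_{1,2} \\ T_{2,1} & T_{2,2} \end{pmatrix}\in\mathscr{B}(E): T_{1,1}\text{ is compact}\right\} \] is a maximal two-sided ideal of codimension one in $\mathscr{B}(E)$, and hence also a maximal left ideal. Moreover, $\mathscr{K}_1$ is singly generated as a left ideal, and it is not fixed.
   Context: All Banach spaces are complex; operators are bounded and linear, and $\mathscr{B}(E)$ is the Banach algebra of operators on $E$. $X_{\mathrm{AH}}$ denotes Argyros–Haydon's Banach space (S. A. Argyros and R. G. Haydon, Acta Math. 206 (2011), 1–54); it is a Banach space with the following properties, which are a theorem of Argyros and Haydon and may be taken as given: (1) $X_{\mathrm{AH}}$ has very few operators, that is, it is infinite-dimensional and each operator on it is the sum of a scalar multiple of the identity and a compact operator; (2) $X_{\mathrm{AH}}$ has a Schauder basis; (3) the dual space of $X_{\mathrm{AH}}$ is isomorphic to $\ell_1$. $\ell_\infty=\ell_\infty(\mathbb{N})$ is the Banach space of bounded complex sequences with the supremum norm. $X_{\mathrm{AH}}\oplus\ell_\infty$ carries the norm $\|(x,f)\|=\max\{\|x\|,\|f\|_\infty\}$. Operators $T$ on $E$ are identified with $2\times2$ matrices with entries $T_{1,1}\colon X_{\mathrm{AH}}\to X_{\mathrm{AH}}$, $T_{1,2}\colon\ell_\infty\to X_{\mathrm{AH}}$, $T_{2,1}\colon X_{\mathrm{AH}}\to\ell_\infty$, $T_{2,2}\colon\ell_\infty\to\ell_\infty$.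 A left ideal is singly generated if it equals $\{ST: S\in\mathscr{B}(E)\}$ for some $T\in\mathscr{B}(E)$. A maximal left ideal is fixed if it equals $\{T\in\mathscr{B}(E):Tx=0\}$ for some $x\in E\setminus\{0\}$. *)

(* Defs.v *)
From HB Require Import structures.
From mathcomp Require Import all_boot all_order all_algebra.
From mathcomp Require Import all_classical all_reals all_analysis.
From mathcomp Require Import complex.

Set Implicit Arguments.
Unset Strict Implicit.
Unset Printing Implicit Defensive.

Import Order.TTheory GRing.Theory Num.Theory.
Import numFieldNormedType.Exports.

Local Open Scope classical_set_scope.
Local Open Scope ring_scope.
Local Open Scope complex_scope.

(* The norm of a normed module over R[i] takes its values in R[i]; rnorm is the
   same norm seen as an element of R, where suprema and sums are available. *)
Definition rnorm (R : realType) (V : normedModType R[i]) (x : V) : R :=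
  complex.Re `|x|.

Section RNorm.
Context (R : realType) (V : normedModType R[i]).
Implicit Types x y : V.

Lemma rnormE x : (rnorm x)%:C = `|x|.
Proof. by rewrite /rnorm (RRe_real (ger0_real (normr_ge0 x))). Qed.

Lemma rnorm_ge0 x : 0 <= rnorm x.
Proof. by rewrite -(@lecR R) rnormE normr_ge0. Qed.

Lemma rnormD x y : rnorm (x + y) <= rnorm x + rnorm y.
Proof. by rewrite -lecR rmorphD/= !rnormE ler_normD. Qed.

Lemma rnormZ (k : R[i]) x : rnorm (k *: x) = rnorm (k : R[i]^o) * rnorm x.
Proof.
by apply: (@complexI R); rewrite rmorphM/= !rnormE normrZ.
Qed.

Lemma rnorm0 : rnorm (0 : V) = 0.
Proof. by rewrite /rnorm normr0. Qed.

Lemma rnorm_eq0 x : rnorm x = 0 -> x = 0.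
Proof. by move=> x0; apply/normr0_eq0; rewrite -rnormE x0. Qed.

End RNorm.

Section BoundedOperators.
Context (R : realType) (V W : normedModType R[i]).

Definition bop_pred : {pred V -> W} :=
  [pred T | `[< linear T /\ continuous T >]].

Record bop := Bop { bop_fun :> V -> W; bop_subproof : bop_fun \in bop_pred }.

HB.instance Definition _ := [isSub for bop_fun].
HB.instance Definition _ := [Choice of bop by <:].

Lemma bop_submod_closed : submod_closed bop_pred.
Proof.
split=> [|a S T /asboolP[linS contS] /asboolP[linT contT]].
  apply/asboolP; split=> [k x y|]; first by rewrite scaler0 addr0.
  exact: cst_continuous.
apply/asboolP; split=> [k x y|x].
  rewrite !fctE linS linT !scalerDr !scalerA (mulrC a k) -!addrA; congr (_ + _).
  by rewrite addrCA.
by apply: cvgD (contT x); apply: cvgZr (contS x).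
Qed.

HB.instance Definition _ :=
  GRing.isSubmodClosed.Build _ _ bop_pred bop_submod_closed.
HB.instance Definition _ := [SubChoice_isSubLmodule of bop by <:].

Lemma bop_linear (T : bop) : linear T.
Proof. by case: T => f /= /asboolP[]. Qed.

Lemma bop_continuous (T : bop) : continuous T.
Proof. by case: T => f /= /asboolP[]. Qed.

HB.instance Definition _ (T : bop) :=
  GRing.isLinear.Build R[i] V W *:%R (bop_fun T) (bop_linear T).

Lemma bopP (S T : bop) : S =1 T -> S = T.
Proof. by move=> ST; apply/val_inj/funext. Qed.

Definition opnorm (T : bop) : R :=
  sup [set rnorm (T x) | x in [set x | rnorm x <= 1]].

Lemma opnorm_has_sup (T : bop) :
  has_sup [set rnorm (T x) | x in [set x | rnorm x <= 1]].
Proof.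
split; first by exists (rnorm (T 0)), 0 => //=; rewrite rnorm0.
have /linear_bounded_continuous/linear_boundedP := @bop_continuous T.
move=> /pinfty_ex_gt0[M M0 TM]; exists (complex.Re M) => _ [x /= x1 <-].
rewrite -lecR rnormE (RRe_real (ger0_real (ltW M0))).
by rewrite (le_trans (TM x))// ger_pMr// -rnormE lecR.
Qed.

Lemma opnorm_ge0 (T : bop) : 0 <= opnorm T.
Proof.
apply: (le_trans (rnorm_ge0 (T 0))); apply: ub_le_sup.
  by have [] := opnorm_has_sup T.
by exists 0 => //=; rewrite rnorm0.
Qed.

Lemma le_opnorm (T : bop) x : rnorm (T x) <= opnorm T * rnorm x.
Proof.
have [->|x0] := eqVneq x 0; first by rewrite linear0 !rnorm0 mulr0.
have nx0 : 0 < rnorm x.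
  by rewrite lt_neqAle rnorm_ge0 andbT eq_sym; apply: contra_neq x0 => /rnorm_eq0.
have rinv : rnorm ((rnorm x)^-1%:C : R[i]^o) = (rnorm x)^-1.
  apply: (@complexI R); rewrite rnormE ger0_norm// lecR invr_ge0//.
  exact: rnorm_ge0.
rewrite -ler_pdivrMr// mulrC -rinv -rnormZ -linearZ; apply: ub_le_sup.
  by have [] := opnorm_has_sup T.
by exists ((rnorm x)^-1%:C *: x) => //=; rewrite rnormZ rinv mulVf// gt_eqF.
Qed.

Lemma opnorm_le (T : bop) (M : R) :
  (forall x, rnorm x <= 1 -> rnorm (T x) <= M) -> opnorm T <= M.
Proof.
move=> TM; apply: ge_sup; first by have [] := opnorm_has_sup T.
by move=> _ [x x1 <-]; exact: TM.
Qed.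

Let norm_bop (T : bop) : R[i] := (opnorm T)%:C.

Let norm_bopD S T : norm_bop (S + T) <= norm_bop S + norm_bop T.
Proof.
rewrite /norm_bop -rmorphD lecR; apply: opnorm_le => x x1.
rewrite (le_trans (rnormD _ _))// lerD// (le_trans (le_opnorm _ _))//.
  by rewrite ler_piMr// opnorm_ge0.
by rewrite ler_piMr// opnorm_ge0.
Qed.

Let norm_bopZ_le (k : R[i]) T :
  opnorm (k *: T) <= rnorm (k : R[i]^o) * opnorm T.
Proof.
apply: opnorm_le => x x1; rewrite -[(k *: T) x]/(k *: T x) rnormZ.
rewrite ler_wpM2l ?rnorm_ge0// (le_trans (le_opnorm _ _))//.
by rewrite ler_piMr// opnorm_ge0.
Qed.

Let norm_bopZ (k : R[i]) T : norm_bop (k *: T) = `|k| * norm_bop T.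
Proof.
rewrite /norm_bop -[`|k|](rnormE (k : R[i]^o)) -rmorphM; congr (_%:C).
apply/eqP; rewrite eq_le norm_bopZ_le/=.
have [->|k0] := eqVneq k 0; first by rewrite rnorm0 mul0r opnorm_ge0.
have nk0 : 0 < rnorm (k : R[i]^o).
  by rewrite lt_neqAle rnorm_ge0 andbT eq_sym; apply: contra_neq k0 => /rnorm_eq0.
rewrite -ler_pdivlMl// -[X in opnorm X <= _](scalerK k0).
rewrite (le_trans (norm_bopZ_le _ _))// ler_wpM2r ?opnorm_ge0//.
by rewrite -lecR rmorphV ?unitfE ?gt_eqF//= !rnormE normfV.
Qed.

Let norm_bop0 T : norm_bop T = 0 -> T = 0.
Proof.
move=> /(@complexI R) T0; apply: bopP => x; apply/rnorm_eq0/eqP.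
by rewrite eq_le rnorm_ge0 andbT (le_trans (le_opnorm T x))// T0 mul0r.
Qed.

HB.instance Definition _ :=
  Lmodule_isNormed.Build R[i] bop norm_bopD norm_bopZ norm_bop0.

End BoundedOperators.

Arguments bop {R} V W.

Section BoundedOperatorAlgebra.
Context (R : realType).

Program Definition bop_id (V : normedModType R[i]) : bop V V := @Bop R V V id _.
Next Obligation. by move=> V; apply/asboolP; split=> // x; exact: cvg_id. Qed.

Program Definition bop_comp (U V W : normedModType R[i])
  (S : bop V W) (T : bop U V) : bop U W := @Bop R U W (S \o T) _.
Next Obligation.
move=> U V W S T; apply/asboolP; split=> [k x y|x] /=; first by rewrite !linearP.
by apply: continuous_comp; exact: bop_continuous.
Qed.

Context (V : normedModType R[i]).
Implicit Types S T U : bop V V.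

Let compA : associative (@bop_comp V V V).
Proof. by move=> S T U; exact: bopP. Qed.
Let comp1l : left_id (bop_id V) (@bop_comp V V V).
Proof. by move=> T; exact: bopP. Qed.
Let comp1r : right_id (bop_id V) (@bop_comp V V V).
Proof. by move=> T; exact: bopP. Qed.
Let compDl : left_distributive (@bop_comp V V V) +%R.
Proof. by move=> S T U; exact: bopP. Qed.
Let compDr : right_distributive (@bop_comp V V V) +%R.
Proof. by move=> S T U; apply: bopP => x; exact: (linearD S). Qed.

HB.instance Definition _ := GRing.Zmodule_isPzRing.Build (bop V V)
  compA comp1l comp1r compDl compDr.

Lemma bopM S T x : (S * T) x = S (T x). Proof. by []. Qed.

Lemma bop1 x : (1 : bop V V) x = x. Proof. by []. Qed.

Lemma bop_scalerAl (k : R[i]) S T : k *: (S * T) = (k *: S) * T.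
Proof. exact: bopP. Qed.

Lemma bop_scalerAr (k : R[i]) S T : k *: (S * T) = S * (k *: T).
Proof. by apply: bopP => x; exact/esym/(linearZ_LR S). Qed.

Lemma bop_normM S T : `|S * T| <= `|S| * `|T|.
Proof.
rewrite -[`|S|]/(opnorm S)%:C -[`|T|]/(opnorm T)%:C -[`|S * T|]/(opnorm _)%:C.
rewrite -rmorphM lecR; apply: opnorm_le => x x1; rewrite bopM.
rewrite (le_trans (le_opnorm _ _))// ler_wpM2l ?opnorm_ge0//.
by rewrite (le_trans (le_opnorm _ _))// ler_piMr// opnorm_ge0.
Qed.

End BoundedOperatorAlgebra.

Section EllInfty.
Context (R : realType).

Definition ell_infty_pred : {pred nat -> R[i]^o} :=
  [pred f | `[< exists M : R, forall n, rnorm (f n) <= M >]].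

Record ell_infty := EllInfty {
  ell_infty_fun :> nat -> R[i]^o;
  ell_infty_subproof : ell_infty_fun \in ell_infty_pred }.

HB.instance Definition _ := [isSub for ell_infty_fun].
HB.instance Definition _ := [Choice of ell_infty by <:].

Lemma ell_infty_submod_closed : submod_closed ell_infty_pred.
Proof.
split=> [|a f g /asboolP[M fM] /asboolP[N gN]]; apply/asboolP.
  by exists 0 => n; rewrite rnorm0.
exists (rnorm (a : R[i]^o) * M + N) => n.
by rewrite (le_trans (rnormD _ _))// lerD// rnormZ ler_wpM2l// rnorm_ge0.
Qed.

HB.instance Definition _ :=
  GRing.isSubmodClosed.Build _ _ ell_infty_pred ell_infty_submod_closed.
HB.instance Definition _ := [SubChoice_isSubLmodule of ell_infty by <:].

Definition supnorm (f : ell_infty) : R := sup (range (fun n => rnorm (f n))).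

Lemma supnorm_has_sup (f : ell_infty) :
  has_sup (range (fun n => rnorm (f n))).
Proof.
split; first by exists (rnorm (f 0)), 0.
by case: f => f /= /asboolP[M fM]; exists M => _ [n _ <-].
Qed.

Lemma le_supnorm (f : ell_infty) n : rnorm (f n) <= supnorm f.
Proof.
by apply: ub_le_sup; [have [] := supnorm_has_sup f|exists n].
Qed.

Lemma supnorm_le (f : ell_infty) (M : R) :
  (forall n, rnorm (f n) <= M) -> supnorm f <= M.
Proof.
move=> fM; apply: ge_sup; first by have [] := supnorm_has_sup f.
by move=> _ [n _ <-].
Qed.

Let norm_infty (f : ell_infty) : R[i] := (supnorm f)%:C.

Let norm_inftyD f g : norm_infty (f + g) <= norm_infty f + norm_infty g.
Proof.
rewrite /norm_infty -rmorphD lecR; apply: supnorm_le => n.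
by rewrite (le_trans (rnormD _ _))// lerD// le_supnorm.
Qed.

Let norm_inftyZ_le (k : R[i]) f :
  supnorm (k *: f) <= rnorm (k : R[i]^o) * supnorm f.
Proof.
apply: supnorm_le => n; rewrite -[(k *: f) n]/(k *: f n) rnormZ.
by rewrite ler_wpM2l ?rnorm_ge0// le_supnorm.
Qed.

Let norm_inftyZ (k : R[i]) f : norm_infty (k *: f) = `|k| * norm_infty f.
Proof.
rewrite /norm_infty -[`|k|](rnormE (k : R[i]^o)) -rmorphM; congr (_%:C).
apply/eqP; rewrite eq_le norm_inftyZ_le/=.
have [->|k0] := eqVneq k 0.
  by rewrite rnorm0 mul0r (le_trans _ (le_supnorm _ 0))// rnorm_ge0.
have nk0 : 0 < rnorm (k : R[i]^o).
  by rewrite lt_neqAle rnorm_ge0 andbT eq_sym; apply: contra_neq k0 => /rnorm_eq0.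
rewrite -ler_pdivlMl//; apply: supnorm_le => n.
by rewrite ler_pdivlMl// -rnormZ; exact: le_supnorm (k *: f) n.
Qed.

Let norm_infty0 f : norm_infty f = 0 -> f = 0.
Proof.
move=> /(@complexI R) f0; apply/val_inj/funext => n; apply/rnorm_eq0/eqP.
by rewrite eq_le rnorm_ge0 andbT -f0 le_supnorm.
Qed.

HB.instance Definition _ :=
  Lmodule_isNormed.Build R[i] ell_infty norm_inftyD norm_inftyZ norm_infty0.

End EllInfty.

Section EllOne.
Context (R : realType).

Definition ell_one_pred : {pred nat -> R[i]^o} :=
  [pred a | `[< cvgn (series (fun n => rnorm (a n))) >]].

Record ell_one := EllOne {
  ell_one_fun :> nat -> R[i]^o;
  ell_one_subproof : ell_one_fun \in ell_one_pred }.

HB.instance Definition _ := [isSub for ell_one_fun].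
HB.instance Definition _ := [Choice of ell_one by <:].

Let rnormD_seq (a b : nat -> R[i]^o) (k : R[i]) n :
  rnorm (k *: a n + b n) <=
  (rnorm (k : R[i]^o) *: ((fun n => rnorm (a n)) : R^nat)
    + (fun n => rnorm (b n))) n.
Proof. by rewrite (le_trans (rnormD _ _))// rnormZ. Qed.

Lemma ell_one_submod_closed : submod_closed ell_one_pred.
Proof.
split=> [|k a b /asboolP ca /asboolP cb]; apply/asboolP.
  have -> : (fun n => rnorm ((0 : nat -> R[i]^o) n)) = (fun=> 0).
    by apply/funext => n; rewrite rnorm0.
  suff -> : series (fun=> 0 : R) = (fun=> 0) by exact: is_cvg_cst.
  by apply/funext => n; rewrite /series/= big1.
apply: (series_le_cvg _ _ (rnormD_seq a b k)) => [n|n|]; first exact: rnorm_ge0.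
  exact: le_trans (rnorm_ge0 _) (rnormD_seq a b k n).
by apply: is_cvg_seriesD; [exact: is_cvg_seriesZ|].
Qed.

HB.instance Definition _ :=
  GRing.isSubmodClosed.Build _ _ ell_one_pred ell_one_submod_closed.
HB.instance Definition _ := [SubChoice_isSubLmodule of ell_one by <:].

Definition sumnorm (a : ell_one) : R := limn (series (fun n => rnorm (a n))).

Lemma sumnorm_cvg (a : ell_one) : cvgn (series (fun n => rnorm (a n))).
Proof. by case: a => a /= /asboolP. Qed.

Lemma le_sumnorm (a : ell_one) n : rnorm (a n) <= sumnorm a.
Proof.
have nd : nondecreasing_seq (series (fun n => rnorm (a n))).
  by apply: nondecreasing_series => k _ _; exact: rnorm_ge0.
apply: le_trans (nondecreasing_cvgn_le nd (@sumnorm_cvg a) n.+1).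
by rewrite seriesSr lerDr sumr_ge0// => k _; exact: rnorm_ge0.
Qed.

Let norm_one (a : ell_one) : R[i] := (sumnorm a)%:C.

Let norm_oneD a b : norm_one (a + b) <= norm_one a + norm_one b.
Proof.
rewrite /norm_one -rmorphD lecR -[X in _ <= X]lim_seriesD; try exact: sumnorm_cvg.
apply: lim_series_le; first exact: sumnorm_cvg.
  by apply: is_cvg_seriesD; exact: sumnorm_cvg.
by move=> n; exact: rnormD.
Qed.

Let norm_oneZ (k : R[i]) a : norm_one (k *: a) = `|k| * norm_one a.
Proof.
rewrite /norm_one -[`|k|](rnormE (k : R[i]^o)) -rmorphM; congr (_%:C).
rewrite /sumnorm -[RHS]lim_seriesZ; last exact: sumnorm_cvg.
by congr (limn (series _)); apply/funext => n; exact: rnormZ.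
Qed.

Let norm_one0 a : norm_one a = 0 -> a = 0.
Proof.
move=> /(@complexI R) a0; apply/val_inj/funext => n; apply/rnorm_eq0/eqP.
by rewrite eq_le rnorm_ge0 andbT -a0 le_sumnorm.
Qed.

HB.instance Definition _ :=
  Lmodule_isNormed.Build R[i] ell_one norm_oneD norm_oneZ norm_one0.

End EllOne.

Section BanachSpaceNotions.
Context (R : realType).
Implicit Types V W : normedModType R[i].

Definition compact_op V W (T : bop V W) : Prop :=
  precompact (T @` [set x | `|x| <= 1]).

Definition infinite_dimensional V : Prop :=
  forall (n : nat) (e : 'I_n -> V),
    exists x, forall a : 'I_n -> R[i], x <> \sum_(i < n) a i *: e i.

Definition very_few_operators V : Prop :=
  infinite_dimensional V /\
  forall T : bop V V, exists (c : R[i]) (S : bop V V),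
    compact_op S /\ T = c *: (1 : bop V V) + S.

Definition has_schauder_basis V : Prop :=
  exists e : nat -> V, forall x : V,
    exists! a : nat -> R[i], series (fun n => a n *: e n) @ \oo --> x.

Definition dual V : normedModType R[i] := bop V R[i]^o.

Definition isomorphic V W : Prop :=
  exists (f : bop V W) (g : bop W V), cancel f g /\ cancel g f.

End BanachSpaceNotions.

(* In a unital algebra closure under scalar multiplication is automatic, so the
   ideals of the algebra are the ideals of the underlying ring. *)
Section Ideals.
Context (A : pzRingType).
Implicit Types I J : set A.

Definition left_ideal I : Prop :=
  [/\ I 0, (forall x y, I x -> I y -> I (x + y))
    & (forall a x, I x -> I (a * x))].

Definition two_sided_ideal I : Prop :=
  left_ideal I /\ forall x a, I x -> I (x * a).

Definition maximal_left_ideal I : Prop :=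
  [/\ left_ideal I, I <> setT
    & forall J, left_ideal J -> I `<=` J -> J = I \/ J = setT].

Definition maximal_two_sided_ideal I : Prop :=
  [/\ two_sided_ideal I, I <> setT
    & forall J, two_sided_ideal J -> I `<=` J -> J = I \/ J = setT].

Definition singly_generated_left_ideal I : Prop :=
  exists t : A, I = [set s * t | s in [set: A]].

End Ideals.

(* For a linear subspace I of V: the cosets of v 0, ..., v (n - 1) form a basis
   of V / I. *)
Definition has_codim (K : fieldType) (V : lmodType K) (n : nat) (I : set V) :
    Prop :=
  exists v : 'I_n -> V, forall x : V,
    exists! c : 'I_n -> K, I (x - \sum_(i < n) c i *: v i).

Definition fixed_left_ideal (R : realType) (V : normedModType R[i])
    (I : set (bop V V)) : Prop :=
  exists2 x : V, x != 0 & I = [set T : bop V V | T x = 0].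

Section DirectSum.
Context (R : realType) (V W : normedModType R[i]).

Program Definition bop_inl : bop V (V * W)%type := @Bop R _ _ (fun x => (x, 0)) _.
Next Obligation.
apply/asboolP; split=> [k x y|x]; last first.
  by apply: cvg_pair; [exact: cvg_id|exact: cvg_cst].
by rewrite -[RHS]/(k *: x + y, k *: 0 + 0) scaler0 addr0.
Qed.

Program Definition bop_fst : bop (V * W)%type V := @Bop R _ _ fst _.
Next Obligation. by apply/asboolP; split=> // x; exact: cvg_fst. Qed.

Definition entry11 (T : bop (V * W)%type (V * W)%type) : bop V V :=
  bop_comp bop_fst (bop_comp T bop_inl).

Lemma entry11E T x : entry11 T x = (T (x, 0)).1. Proof. by []. Qed.

End DirectSum.

(* X is to be read as the Argyros-Haydon space; T |-> entry11 T below is the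
   top left entry of the 2 x 2 matrix of T. *)
Definition E_sum (R : realType) (X : normedModType R[i]) : normedModType R[i] :=
  (X * ell_infty R)%type.

Definition K_1 (R : realType) (X : normedModType R[i]) :
    set (bop (E_sum X) (E_sum X)) :=
  [set T | compact_op (entry11 T)].

Arguments K_1 {R} X.

Lemma E_sum_norm (R : realType) (X : normedModType R[i]) (z : E_sum X) :
  `|z| = Num.max `|z.1| `|z.2|.
Proof. by []. Qed.

(* Main.v *)
Require Import Defs.
From HB Require Import structures.
From mathcomp Require Import all_boot all_order all_algebra.
From mathcomp Require Import all_classical all_reals all_analysis.
From mathcomp Require Import complex.
From mathcomp Require Import lra.

(** Write E for the direct sum of X and the bounded sequences, and phi_n for the
    functionals on X that an isomorphism of the dual of X with the summable
    sequences attaches to the unit vectors.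

    Maximality and codimension one.  Every operator on X is a scalar plus a
    compact operator, and the scalar is unique because X is
    infinite-dimensional.  So each operator on E differs from a scalar by a
    member of K_1, and everything reduces to K_1 being an ideal.  The top left
    entry of a product S T is S11 T11 + S12 T21, so what is needed is that every
    product A B, with A from the bounded sequences to X and B from X to the
    bounded sequences, is compact ([infty_factor_compact]).

    Such a product is a scalar c plus a compact operator.  Since X is
    infinite-dimensional and the phi_n span a dense subspace of its dual, there
    are unit vectors z_m that tend weakly to zero
    ([weakly_null_unit_sequence]); compact operators make their images come
    arbitrarily close to zero ([compact_op_weakly_null]).  If A B z_m tends to
    zero as well, then c = 0.  That it does is [factor_weakly_null].  For a set
    F of indices let v(F) be the norm of A on the sequences supported in F; this
    is monotone and subadditive.  The space X is separable, because it has a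
    basis, and this makes v tend to zero along disjoint sets: otherwise, by
    Rosenthal's lemma, the power set of the natural numbers would embed in X
    with separated image ([separable_exhaustive]).  If A B z_m did not tend to
    zero, the sets F_m on which B z_m is large would have v(F_m) bounded away
    from zero for infinitely many m, and infinitely many of them would belong to
    one ultrafilter.  The limit of the entries of B x along it is a functional of
    x that does not tend to zero on z_m, a contradiction.

    One generator.  Let U x be the sequence of the phi_n(x).  An operator from X
    to the bounded sequences, and a compact operator on X, both factor as S U for
    some S defined on all bounded sequences ([extension_infty],
    [extension_compact]).  By Helly's theorem, which follows from the
    Hahn-Banach theorem, each bounded sequence F is a coordinatewise limit of
    sequences U x with x bounded.  As the phi_n span a dense subspace, F acts on
    the dual of X, and the adjoint of a compact operator carries this action to
    evaluation at a vector of X.  Now interleave U x with h, for (x, h) in E: the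
    operator on E that puts the result into the second summand lies in K_1, and
    every T in K_1 is a left multiple of it, by extending T11 and T21 along U
    ([K1_generator]).

    Not fixed.  That generator is injective, so no nonzero vector is
    annihilated by K_1. *)

Set Implicit Arguments.
Unset Strict Implicit.
Unset Printing Implicit Defensive.

Import Order.TTheory GRing.Theory Num.Theory.
Import numFieldNormedType.Exports.

Local Open Scope classical_set_scope.
Local Open Scope ring_scope.
Local Open Scope complex_scope.

(** * The modulus of a complex number *)

Section Modulus.
Context {R : realType}.
Implicit Types z w : R[i].

Definition modulus z : R := rnorm (z : R[i]^o).

Lemma modulusE z : (modulus z)%:C = `|z|.
Proof. exact: (rnormE (z : R[i]^o)). Qed.

Lemma modulus_ge0 z : 0 <= modulus z.
Proof. exact: rnorm_ge0. Qed.

Lemma modulus0 : modulus 0 = 0.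
Proof. exact: rnorm0. Qed.

Lemma modulus_eq0 z : modulus z = 0 -> z = 0.
Proof. exact: (@rnorm_eq0 _ (R[i]^o)). Qed.

Lemma modulusD z w : modulus (z + w) <= modulus z + modulus w.
Proof. exact: (@rnormD _ (R[i]^o)). Qed.

Lemma modulusM z w : modulus (z * w) = modulus z * modulus w.
Proof. exact: (@rnormZ _ (R[i]^o)). Qed.

Lemma modulusR (r : R) : modulus r%:C = `|r|.
Proof.
by apply: (@complexI R); rewrite modulusE normc_def /= expr0n addr0 sqrtr_sqr.
Qed.

Lemma modulusN z : modulus (- z) = modulus z.
Proof.
rewrite -mulN1r modulusM -[-1](rmorphN1 (real_complex R)) modulusR.
by rewrite normrN1 mul1r.
Qed.

Lemma modulusB z w : modulus (z - w) = modulus (w - z).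
Proof. by rewrite -modulusN opprB. Qed.

Lemma modulus1 : modulus 1 = 1.
Proof. by rewrite -[1](rmorph1 (real_complex R)) modulusR normr1. Qed.

Lemma modulus_gt0 z : z != 0 -> 0 < modulus z.
Proof.
move=> z0; rewrite lt_neqAle modulus_ge0 andbT eq_sym.
by apply: contra_neq z0; exact: modulus_eq0.
Qed.

Lemma norm_Re_modulus z : `|complex.Re z| <= modulus z.
Proof. by rewrite -lecR modulusE; exact: normc_ge_Re. Qed.

Lemma modulus_i : modulus 'i%C = 1.
Proof.
apply: (@complexI R).
by rewrite modulusE normc_def /= expr1n expr0n add0r sqrtr1.
Qed.

Lemma norm_Im_modulus z : `|complex.Im z| <= modulus z.
Proof.
have -> : modulus z = modulus (z * 'i) by rewrite modulusM modulus_i mulr1.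
by rewrite -normrN -ReiNIm; exact: norm_Re_modulus.
Qed.

Lemma modulus_le_ReIm z : modulus z <= `|complex.Re z| + `|complex.Im z|.
Proof.
rewrite {1}(complexE z) (le_trans (modulusD _ _))// modulusM !modulusR.
by rewrite modulus_i mul1r.
Qed.

(** Rotating a number onto the positive half-line turns bounds on real parts
    into bounds on moduli. *)
Lemma phaseP z : exists2 u : R[i], modulus u = 1 & u * z = (modulus z)%:C.
Proof.
have [->|z0] := eqVneq z 0.
  by exists 1; rewrite ?modulus1// mulr0 modulus0.
exists ((modulus z)%:C / z); last by rewrite divfK.
have mz : modulus z != 0 by rewrite gt_eqF// modulus_gt0.
rewrite modulusM modulusR ger0_norm ?modulus_ge0//.
by apply: (mulIf mz); rewrite -mulrA -modulusM mulVf// modulus1 mulr1 mul1r.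
Qed.

End Modulus.

(** * The Hahn-Banach theorem for complex seminorms *)

Section HahnBanach.
Context (R : realType) (V : lmodType R[i]) (p : V -> R).
Hypothesis pD : forall x y, p (x + y) <= p x + p y.
Hypothesis pZ : forall (k : R[i]) x, p (k *: x) = modulus k * p x.

Let p0 : p 0 = 0.
Proof. by rewrite -(scale0r 0) pZ modulus0 mul0r. Qed.

Let pN x : p (- x) = p x.
Proof. by rewrite -scaleN1r pZ modulusN modulus1 mul1r. Qed.

Let p_ge0 x : 0 <= p x.
Proof. by have := pD x (- x); rewrite subrr p0 pN -mulr2n pmulrn_lge0. Qed.

Section Real.
Variable v : V.

(** A set of pairs that is closed under real combinations and lies below p is
    the graph of a real-linear functional: (0, s) in it forces s <= 0 and
    - s <= 0.  The first clause is conditional so that the empty set qualifies,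
    as the union of the empty chain must. *)
Let dominated_graph (A : set (V * R)) :=
  [/\ forall z, A z -> A (v, p v),
      forall x a y b (r : R), A (x, a) -> A (y, b) ->
        A (x + r%:C *: y, a + r * b)
    & forall x a, A (x, a) -> a <= p x].

Let graph_eq A x a b : dominated_graph A -> A (x, a) -> A (x, b) -> a = b.
Proof.
move=> [_ AD Ap] xa xb.
have key c d : A (x, c) -> A (x, d) -> c <= d.
  move=> xc xd; have := Ap _ _ (AD _ _ _ _ (-1) xc xd).
  by rewrite rmorphN1 scaleN1r subrr p0 mulN1r subr_le0.
by apply/eqP; rewrite eq_le !key.
Qed.

(** The new value at x is the supremum of b - p (y - x) over the graph; by
    subadditivity it is at most every p (y + x) - b. *)
Let extend A x : dominated_graph A -> A (v, p v) ->
  exists2 B, dominated_graph B & A `<=` B /\ exists a, B (x, a).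
Proof.
move=> gA Av; have [_ AD Ap] := gA.
have A0 : A (0, 0).
  by have := AD _ _ _ _ (-1) Av Av; rewrite rmorphN1 scaleN1r mulN1r !subrr.
have AZ y b r : A (y, b) -> A (r%:C *: y, r * b).
  by move=> /(AD _ _ _ _ r A0); rewrite !add0r.
have AA y b y' b' : A (y, b) -> A (y', b') -> A (y + y', b + b').
  by move=> h /(AD _ _ _ _ 1 h); rewrite scale1r mul1r.
have realV (r : R) : r != 0 -> r%:C * r^-1%:C = 1.
  by move=> r0; rewrite -(rmorphM (real_complex R)) mulfV.
have posZ (r : R) y : 0 < r -> r * p y = p (r%:C *: y).
  by move=> r0; rewrite pZ modulusR gtr0_norm.
pose L := [set z.2 - p (z.1 - x) | z in A].
have Lub y b : A (y, b) -> ubound L (p (y + x) - b).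
  move=> yb _ [[y' b'] /= yb' <-]; rewrite lerBlDr addrAC lerBrDr.
  rewrite (le_trans (Ap _ _ (AA _ _ _ _ yb' yb)))//.
  have -> : y' + y = (y + x) + (y' - x) by rewrite addrACA subrr addr0 addrC.
  exact: pD.
have supL : has_sup L.
  by split; [exists (0 - p (0 - x)), (0, 0)|exists (p (0 + x) - 0); exact: Lub].
pose al := sup L.
have al_le y b : A (y, b) -> al <= p (y + x) - b.
  by move=> /Lub; apply: ge_sup; case: supL.
have le_al y b : A (y, b) -> b - p (y - x) <= al.
  by move=> yb; apply: ub_le_sup; [case: supL|exists (y, b)].
exists [set z | exists y b t, [/\ A (y, b), z.1 = y + t%:C *: x & z.2 = b + t * al]].
  split=> [_ _|_ _ _ _ r [y [b [t [yb /= -> ->]]]] [z [c [s [zc /= -> ->]]]]|].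
  - by exists v, (p v), 0; rewrite /= scale0r mul0r !addr0.
  - exists (y + r%:C *: z), (b + r * c), (t + r * s); split=> /=.
    + exact: AD.
    + by rewrite scalerDr addrACA scalerA -scalerDl -rmorphM -rmorphD.
    + by rewrite mulrDr addrACA mulrA -mulrDl.
  - move=> _ _ [y [b [t [yb /= -> ->]]]].
    have [t0|t0|<-] := ltgtP 0 t; last by rewrite scale0r mul0r !addr0 Ap.
    + have := al_le _ _ (AZ _ _ t^-1 yb).
      rewrite lerBrDr -(ler_pM2l t0) mulrDr mulVKf ?gt_eqF// addrC.
      rewrite posZ// scalerDr scalerA.
      by rewrite realV ?gt_eqF// scale1r.
    + have s0 : 0 < - t by rewrite oppr_gt0.
      have := le_al _ _ (AZ _ _ (- t)^-1 yb).
      rewrite lerBlDr -(ler_pM2l s0) mulrDr mulVKf ?gt_eqF//.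
      rewrite posZ// scalerBr scalerA.
      rewrite realV ?gt_eqF// scale1r rmorphN scaleNr opprK mulNr.
      by rewrite addrC lerBrDr.
split=> [[y b] yb|].
  by exists y, b, 0; rewrite /= scale0r mul0r !addr0.
by exists al, 0, 0, 1; rewrite /= scale1r mul1r !add0r.
Qed.

Let real_hahn_banach : exists f : V -> R,
  [/\ forall x y, f (x + y) = f x + f y,
      forall (r : R) x, f (r%:C *: x) = r * f x,
      forall x, f x <= p x & f v = p v].
Proof.
have [|A [gA Amax]] := @Zorn_bigcup _ dominated_graph.
  move=> F FP totF; split.
  - by move=> z [G FG Gz]; exists G => //; have [/(_ _ Gz)] := FP _ FG.
  - move=> x a y b r [G FG Gx] [H FH Hy].
    have [GH|HG] := totF _ _ FG FH.
      by exists H => //; have [_ + _] := FP _ FH; apply=> //; exact: GH.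
    by exists G => //; have [_ + _] := FP _ FG; apply=> //; exact: HG.
  - by move=> x a [G FG Gx]; have [_ _] := FP _ FG; exact.
have Av : A (v, p v).
  apply: contrapT => nAv; have A0 z : ~ A z by move=> Az; case: gA => /(_ _ Az).
  apply: (Amax [set z | exists t : R, z = (t%:C *: v, t * p v)]).
    split=> [z /A0//|LA]; apply: (A0 (v, p v)); apply: LA.
    by exists 1; rewrite scale1r mul1r.
  split=> [_ _|_ _ _ _ r [t [-> ->]] [s [-> ->]]|_ _ [t [-> ->]]].
  - by exists 1; rewrite scale1r mul1r.
  - exists (t + r * s).
    by rewrite scalerA -rmorphM -scalerDl -rmorphD mulrA -mulrDl.
  - by rewrite pZ modulusR ler_wpM2r// ler_norm.
have tot x : exists a, A (x, a).
  apply: contrapT => nx; have [B gB [AB [a Bx]]] := extend x gA Av.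
  apply: (Amax B) => //; split=> // BA.
  by apply: nx; exists a; exact: BA.
have [f fA] := choice tot; have [_ AD Ap] := gA; exists f; split.
- move=> x y; apply: (graph_eq gA (fA _)).
  by have := AD _ _ _ _ 1 (fA x) (fA y); rewrite scale1r mul1r.
- move=> r x; apply: (graph_eq gA (fA _)).
  have f0 : A (0, 0).
    by have := AD _ _ _ _ (-1) Av Av; rewrite rmorphN1 scaleN1r mulN1r !subrr.
  by have := AD _ _ _ _ r f0 (fA x); rewrite !add0r.
- by move=> x; exact: Ap.
- exact: (graph_eq gA (fA _)).
Qed.

(** A real-linear f is the real part of the complex-linear
    f x - i f (i x), and domination passes to the modulus by rotation. *)
Lemma hahn_banach : exists l : V -> R[i],
  [/\ forall (k : R[i]) x y, l (k *: x + y) = k * l x + l y,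
      forall x, modulus (l x) <= p x & l v = (p v)%:C].
Proof.
have [f [fD fZ fp fv]] := real_hahn_banach.
pose l x := f x +i* (- f ('i%C *: x)).
have lD x y : l (x + y) = l x + l y.
  by rewrite /l scalerDr !fD opprD; apply/eqP; rewrite eq_complex /= !eqxx.
have lZ k x : l (k *: x) = k * l x.
  have lZr r y : l (r%:C *: y) = r%:C * l y.
    rewrite /l scalerA (mulrC 'i%C) -scalerA !fZ.
    by apply/eqP; rewrite eq_complex /= !mul0r subr0 addr0 mulrN !eqxx.
  have lZi y : l ('i%C *: y) = 'i%C * l y.
    rewrite /l scalerA -expr2 sqr_i scaleN1r.
    have -> : f (- y) = - f y.
      by rewrite -scaleN1r -(rmorphN1 (real_complex R)) fZ mulN1r.
    apply/eqP; rewrite eq_complex /=.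
    by rewrite mul0r sub0r mul1r !opprK mul0r mul1r add0r !eqxx.
  rewrite [in LHS](complexE k) scalerDl lD -scalerA lZi !lZr [in RHS](complexE k).
  by rewrite mulrDl -mulrA.
have lp x : modulus (l x) <= p x.
  have [u u1 ul] := phaseP (l x).
  rewrite -[p x]mul1r -u1 -pZ (le_trans _ (fp _))// -[f _]/(complex.Re (l (u *: x))).
  by rewrite lZ ul.
exists l; split=> // [k x y|]; first by rewrite lD lZ.
have := lp v; rewrite -lecR modulusE normc_def lecR /= fv sqrrN => h.
apply/eqP; rewrite eq_complex /= fv eqxx /= oppr_eq0.
have : Num.sqrt (p v ^+ 2 + f ('i%C *: v) ^+ 2) ^+ 2 <= p v ^+ 2.
  by rewrite ler_pXn2r// nnegrE ?sqrtr_ge0.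
rewrite sqr_sqrtr ?addr_ge0 ?sqr_ge0// gerDl => h2.
by rewrite -sqrf_eq0 eq_le h2 sqr_ge0.
Qed.

End Real.
End HahnBanach.

(** * Bounded operators and functionals *)

Section Operators.
Context {R : realType}.
Implicit Types V W : normedModType R[i].

Lemma rnormN V (x : V) : rnorm (- x) = rnorm x.
Proof. by rewrite /rnorm normrN. Qed.

Lemma rnormB V (x y : V) : rnorm (x - y) = rnorm (y - x).
Proof. by rewrite -rnormN opprB. Qed.

Lemma rnorm_gt0 V (x : V) : x != 0 -> 0 < rnorm x.
Proof.
move=> x0; rewrite lt_neqAle rnorm_ge0 andbT eq_sym.
by apply: contra_neq x0; exact: rnorm_eq0.
Qed.

Lemma rnormZr V (r : R) (x : V) : rnorm (r%:C *: x) = `|r| * rnorm x.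
Proof. by rewrite rnormZ -[X in X * _]/(modulus r%:C) modulusR. Qed.

Lemma bounded_linear_bop V W (T : V -> W) (M : R) :
    (forall (k : R[i]) x y, T (k *: x + y) = k *: T x + T y) ->
    (forall x, rnorm (T x) <= M * rnorm x) ->
  exists T' : bop V W, T' =1 T.
Proof.
move=> linT TM.
pose tl := GRing.isLinear.Build R[i] V W *:%R T linT.
pose f : {linear V -> W} := HB.pack T tl.
have cT : continuous f.
  apply: bounded_linear_continuous; apply/linear_boundedP.
  exists M%:C; split; first by apply/complex_realP; exists M.
  move=> r Mr x; rewrite (le_trans _ (ler_wpM2r _ (ltW Mr)))//.
  by rewrite -!rnormE -rmorphM lecR.
have fP : T \in @bop_pred R V W by apply/asboolP.
by exists (Bop fP).
Qed.

Lemma bop_compE V W Z (S : bop W Z) (T : bop V W) x : bop_comp S T x = S (T x).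
Proof. by []. Qed.

Lemma bopDE V W (S T : bop V W) x : (S + T) x = S x + T x.
Proof. by []. Qed.

Lemma bopZE V W k (T : bop V W) x : (k *: T) x = k *: T x.
Proof. by []. Qed.

Lemma le_rnorm_bop V W (T : bop V W) x : rnorm (T x) <= rnorm T * rnorm x.
Proof. exact: le_opnorm. Qed.

Lemma rnorm_bop_le V W (T : bop V W) (M : R) : 0 <= M ->
  (forall x, rnorm (T x) <= M * rnorm x) -> rnorm T <= M.
Proof.
move=> M0 TM; apply: opnorm_le => x x1.
by rewrite (le_trans (TM x))// ler_piMr.
Qed.

Lemma modulus_dual V (psi : dual V) x : modulus (psi x) <= rnorm psi * rnorm x.
Proof. exact: le_opnorm. Qed.

Lemma norming_functional V (x : V) : exists psi : dual V,
  (forall y, modulus (psi y) <= rnorm y) /\ psi x = (rnorm x)%:C.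
Proof.
have [l [llin lle lx]] := hahn_banach (@rnormD R V) (@rnormZ R V) x.
have [psi psil] : exists psi : dual V, psi =1 l.
  by apply: (@bounded_linear_bop V _ _ 1) => // y; rewrite mul1r; exact: lle.
by exists psi; split=> [y|]; rewrite psil.
Qed.

Lemma norming_functional_le1 V (psi : dual V) :
  (forall y, modulus (psi y) <= rnorm y) -> rnorm psi <= 1.
Proof. by move=> h; apply: rnorm_bop_le => // y; rewrite mul1r; exact: h. Qed.

Lemma dual_separates V (x y : V) :
  (forall psi : dual V, psi x = psi y) -> x = y.
Proof.
move=> xy; apply/eqP; rewrite -subr_eq0; apply/eqP/rnorm_eq0.
have [psi [_ psix]] := norming_functional (x - y).
by apply: (@complexI R); rewrite -psix linearB /= xy subrr.
Qed.

End Operators.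

(** * Compact operators *)

Section Compact.
Context {R : realType}.
Implicit Types U V W : normedModType R[i].

Local Notation unit_ball V := [set x : V | `|x| <= 1].

Lemma compact_opP V W (T : bop V W) : compact_op T <->
  exists2 C : set W, compact C & T @` unit_ball V `<=` C.
Proof.
split.
  rewrite /compact_op precompactE; exists (closure (T @` unit_ball V)) => //.
  exact: subset_closure.
move=> [C cC TC]; apply: precompact_subset TC _.
by apply: compact_precompact => //; exact: norm_hausdorff.
Qed.

Lemma compact_opD V W (S T : bop V W) :
  compact_op S -> compact_op T -> compact_op (S + T).
Proof.
move=> /compact_opP[C cC SC] /compact_opP[D cD TD]; apply/compact_opP.
exists ((fun z : W * W => z.1 + z.2) @` (C `*` D)).
  apply: continuous_compact; last exact: compact_setX.
  by apply: continuous_subspaceT => z; exact: add_continuous.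
move=> _ [x x1 <-]; exists (S x, T x) => //.
by split; [apply: SC|apply: TD]; exists x.
Qed.

Lemma compact_op_compl U V W (S : bop V W) (T : bop U V) :
  compact_op T -> compact_op (bop_comp S T).
Proof.
move=> /compact_opP[C cC TC]; apply/compact_opP; exists (S @` C).
  apply: continuous_compact => //; apply: continuous_subspaceT.
  exact: bop_continuous.
by move=> _ [x x1 <-]; exists (T x) => //; apply: TC; exists x.
Qed.

Lemma compact_op_compr U V W (S : bop V W) (T : bop U V) :
  compact_op S -> compact_op (bop_comp S T).
Proof.
move=> /compact_opP[C cC SC]; apply/compact_opP.
pose M := rnorm T + 1; have M0 : 0 < M by rewrite ltr_wpDl// rnorm_ge0.
exists ((fun z : W => M%:C *: z) @` C).
  apply: continuous_compact => //; apply: continuous_subspaceT.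
  exact: scaler_continuous.
move=> _ [x x1 <-]; exists (S ((M^-1)%:C *: T x)).
  apply: SC; exists ((M^-1)%:C *: T x) => //=.
  rewrite -rnormE lecR rnormZr gtr0_norm ?invr_gt0// ler_pdivrMl// mulr1.
  rewrite (le_trans (le_rnorm_bop _ _))//.
  have : rnorm x <= 1 by rewrite -lecR rnormE.
  move=> h; rewrite (le_trans (ler_wpM2l (rnorm_ge0 _) h))// mulr1.
  by rewrite lerDl.
by rewrite /= linearZ scalerA -(rmorphM (real_complex R)) mulfV ?gt_eqF// scale1r.
Qed.

Lemma compact_opZ V W (k : R[i]) (T : bop V W) :
  compact_op T -> compact_op (k *: T).
Proof.
move=> cT; have -> : k *: T = bop_comp (k *: (1 : bop W W)) T by exact: bopP.
exact: compact_op_compl.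
Qed.

Lemma compact_op0 V W : compact_op (0 : bop V W).
Proof.
apply/compact_opP; exists [set 0]; first exact: compact_set1.
by move=> _ [x _ <-].
Qed.

(** An ultrafilter replaces the passage to subsequences: the same one serves
    for the vectors T (x i) and for the values of all functionals at x i. *)
Lemma compact_op_ultra V W (T : bop V W) (I : Type) (F : set_system I)
    (x : I -> V) (M : R) :
    UltraFilter F -> compact_op T -> (forall i, rnorm (x i) <= M) ->
  exists y, forall e : R, 0 < e -> F [set i | rnorm (T (x i) - y) < e].
Proof.
move=> FU cT xM.
pose N := `|M| + 1; have N0 : 0 < N by rewrite ltr_wpDl.
pose TN : bop V W := bop_comp T (N%:C *: (1 : bop V V)).
have /compact_opP[C + TC] : compact_op TN by exact: compact_op_compr.
rewrite compact_ultra => /(_ ((T \o x) @ F)) /=; case.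
- split; first exact: fmap_proper_filter.
  move=> G PG FG; apply/seteqP; split=> [A GA|//].
  have [//|FA] := in_ultra_setVsetC ((T \o x) @^-1` A) FU.
  have := FG (~` A) FA => /(filterI GA); rewrite setICr => /filter_not_empty [].
- apply: filterS filterT => i _ /=; apply: TC; exists ((N^-1)%:C *: x i) => /=.
    rewrite -rnormE lecR rnormZr gtr0_norm ?invr_gt0// ler_pdivrMl// mulr1.
    by rewrite (le_trans (xM i))// (le_trans (ler_norm _))// lerDl.
  rewrite -[LHS]/(T (N%:C *: ((N^-1)%:C *: x i))) scalerA.
  by rewrite -(rmorphM (real_complex R)) mulfV ?gt_eqF// scale1r.
- move=> y [_ Fy]; exists y => e e0.
  have Fye : F ((T \o x) @^-1` ball y e%:C).
    by apply: Fy; apply: nbhsx_ballx; rewrite ltcR.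
  apply: filterS Fye => i /=; rewrite -ball_normE /= -rnormE ltcR.
  by rewrite rnormB.
Qed.

End Compact.

(** * Limits along an ultrafilter *)

Section Ultralimit.
Context {R : realType} {I : Type} (F : set_system I) {FU : UltraFilter F}.
Implicit Types (h g : I -> R[i]) (l : R[i]).

Definition ulim h l : Prop :=
  forall e : R, 0 < e -> F [set i | modulus (h i - l) < e].

Let ulim_real (a : I -> R) (M : R) : (forall i, `|a i| <= M) ->
  exists s : R, forall e, 0 < e -> F [set i | `|a i - s| < e].
Proof.
move=> aM; pose A := [set t : R | F [set i | t <= a i]].
have supA : has_sup A.
  split.
    exists (- M); apply: filterS filterT => i _ /=.
    by have := aM i; rewrite ler_norml => /andP[].
  exists M => t /filter_ex[i /= ti].
  by rewrite (le_trans ti)// (le_trans (ler_norm _)).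
exists (sup A) => e e0.
have [t At tA] := sup_adherent e0 supA.
have [Ae|Ae] := in_ultra_setVsetC [set i | sup A + e <= a i] FU.
  by have := ub_le_sup supA.2 Ae; rewrite gerDl leNgt e0.
apply: filterS (filterI At Ae) => i /= [ti /negP]; rewrite -ltNge => ai.
by rewrite ltr_distl (lt_le_trans tA ti) ai.
Qed.

Lemma ulim_exists h (M : R) : (forall i, modulus (h i) <= M) ->
  exists l, ulim h l.
Proof.
move=> hM.
have [a ha] := ulim_real (fun i => le_trans (norm_Re_modulus (h i)) (hM i)).
have [b hb] := ulim_real (fun i => le_trans (norm_Im_modulus (h i)) (hM i)).
exists (a +i* b) => e e0; have e2 : 0 < e / 2 by rewrite divr_gt0.
apply: filterS (filterI (ha _ e2) (hb _ e2)) => i /= [ai bi].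
rewrite (le_lt_trans (modulus_le_ReIm _))// [ltRHS]splitr.
by case: (h i) ai bi => x y /=; exact: ltrD.
Qed.

Lemma ulim_unique h l l' : ulim h l -> ulim h l' -> l = l'.
Proof.
move=> hl hl'; apply/eqP; rewrite -subr_eq0; apply: contraT => ll'.
have e0 : 0 < modulus (l - l') / 2 by rewrite divr_gt0// modulus_gt0.
have [i /= [h1 h2]] := filter_ex (filterI (hl _ e0) (hl' _ e0)).
suff : modulus (l - l') < modulus (l - l') by rewrite ltxx.
rewrite [ltRHS]splitr (le_lt_trans _ (ltrD h1 h2))//.
rewrite (modulusB (h i) l) (le_trans _ (modulusD _ _))//.
by rewrite addrA subrK.
Qed.

Lemma ulim_linear (k : R[i]) h g a b :
  ulim h a -> ulim g b -> ulim (fun i => k * h i + g i) (k * a + b).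
Proof.
move=> ha hb e e0; have e2 : 0 < e / 2 by rewrite divr_gt0.
have k0 : 0 < modulus k + 1 by rewrite ltr_wpDl// modulus_ge0.
have ek : 0 < e / 2 / (modulus k + 1) by rewrite divr_gt0.
apply: filterS (filterI (ha _ ek) (hb _ e2)) => i /= [ai bi].
rewrite opprD addrACA -mulrBr (le_lt_trans (modulusD _ _))// [ltRHS]splitr.
apply: ler_ltD => //; rewrite modulusM; move: ai; rewrite ltr_pdivlMr// => /ltW.
by apply: le_trans; rewrite mulrC ler_wpM2l ?modulus_ge0// lerDl.
Qed.

Lemma ulim_le h l (M : R) : (forall i, modulus (h i) <= M) -> ulim h l ->
  modulus l <= M.
Proof.
move=> hM hl; apply/ler_addgt0Pr => e e0.
have /filter_ex[i /= hi] := hl _ e0.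
rewrite -[l](subrK (h i)) (le_trans (modulusD _ _))// addrC lerD//.
by rewrite modulusB ltW.
Qed.

End Ultralimit.

Lemma free_ultrafilter : exists F : set_system nat,
  UltraFilter F /\ forall N : nat, F [set n | (N <= n)%N].
Proof.
have [F [FU sF]] := ultraFilterLemma (@eventually_filter).
by exists F; split=> // N; apply: sF; exact: nbhs_infty_ge.
Qed.

(** * Sequence spaces *)

Section SequenceSpaces.
Context {R : realType}.
Implicit Type V : normedModType R[i].

Definition infty_of (f : nat -> R[i]) (M : R)
  (fM : forall n, modulus (f n) <= M) : ell_infty R :=
  @EllInfty R f (introT (asboolP _) (ex_intro _ M fM)).

Lemma infty_ext (f g : ell_infty R) : (forall n, f n = g n) -> f = g.
Proof. by move=> fg; apply/val_inj/funext. Qed.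

Lemma modulus_le_infty (f : ell_infty R) n : modulus (f n) <= rnorm f.
Proof. exact: le_supnorm. Qed.

Lemma rnorm_infty_le (f : ell_infty R) (M : R) :
  (forall n, modulus (f n) <= M) -> rnorm f <= M.
Proof. exact: supnorm_le. Qed.

Lemma inftyE (k : R[i]) (f g : ell_infty R) n :
  (k *: f + g) n = k * f n + g n.
Proof. by []. Qed.

Lemma infty_bop V (t : nat -> V -> R[i]) (M : R) :
    (forall n (k : R[i]) x y, t n (k *: x + y) = k * t n x + t n y) ->
    (forall n x, modulus (t n x) <= M * rnorm x) ->
  exists T : bop V (ell_infty R), forall x n, T x n = t n x.
Proof.
move=> tlin tM; pose T x := infty_of (fun n => tM n x).
have [|x|T' T'E] := @bounded_linear_bop R V (ell_infty R) T M.
- by move=> k x y; apply: infty_ext => n; rewrite inftyE; exact: tlin.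
- by apply: rnorm_infty_le => n; exact: tM.
- by exists T' => x n; rewrite T'E.
Qed.

Lemma infty_ev (n : nat) : exists psi : dual (ell_infty R),
  (forall f, psi f = f n) /\ rnorm psi <= 1.
Proof.
have [||psi psiE] := @bounded_linear_bop R (ell_infty R) R[i]^o (fun f => f n) 1.
- by move=> k x y; rewrite inftyE.
- by move=> f; rewrite mul1r; exact: modulus_le_infty.
exists psi; split=> //; apply: norming_functional_le1 => f.
by rewrite psiE; exact: modulus_le_infty.
Qed.

Lemma finsupp_series (a : nat -> R[i]) N : (forall n, (N <= n)%N -> a n = 0) ->
  series (fun n => rnorm (a n : R[i]^o)) @ \oo --> \sum_(n < N) modulus (a n).
Proof.
move=> a0; apply: cvg_near_cst; exists N => // m /= Nm.
rewrite /series /= (big_cat_nat (leq0n N) Nm) /= big_mkord.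
rewrite [X in _ + X]big_nat_cond [X in _ + X]big1 ?addr0// => n.
by rewrite andbT => /andP[Nn _]; rewrite a0// rnorm0.
Qed.

Definition one_of (a : nat -> R[i]) N (a0 : forall n, (N <= n)%N -> a n = 0) :
  ell_one R :=
  @EllOne R a (introT (asboolP _) (cvgP _ (finsupp_series a0))).

Lemma rnorm_one_of a N (a0 : forall n, (N <= n)%N -> a n = 0) :
  rnorm (one_of a0) = \sum_(n < N) modulus (a n).
Proof. exact: cvg_lim (finsupp_series a0). Qed.

Lemma trunc_zero (a : nat -> R[i]) N n :
  (N <= n)%N -> (if (n < N)%N then a n else 0) = 0.
Proof. by rewrite leqNgt => /negbTE ->. Qed.

Definition one_trunc (a : nat -> R[i]) N : ell_one R := one_of (@trunc_zero a N).

Definition one_unit n : ell_one R := one_trunc (fun k => (k == n)%:R) n.+1.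

Lemma one_unitE n k : one_unit n k = (k == n)%:R.
Proof.
rewrite /one_unit /=; case: ltnP => // nk; case: eqP => // kn.
by move: nk; rewrite kn ltnn.
Qed.

Lemma one_ext (a b : ell_one R) : (forall n, a n = b n) -> a = b.
Proof. by move=> ab; apply/val_inj/funext. Qed.

Lemma one_truncE a N : one_trunc a N = \sum_(n < N) a n *: one_unit n.
Proof.
elim: N => [|N IH]; first by rewrite big_ord0; exact: one_ext.
rewrite big_ord_recr /= -IH; apply: one_ext => k.
rewrite -[RHS]/(one_trunc a N k + a N * one_unit N k) one_unitE /=.
rewrite ltnS leq_eqVlt; case: eqVneq => [->|kN] /=.
  by rewrite ltnn add0r mulr1.
by rewrite mulr0 addr0.
Qed.

Lemma rnorm_one_trunc a N : rnorm (one_trunc a N) = \sum_(n < N) modulus (a n).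
Proof. by rewrite rnorm_one_of; apply: eq_bigr => n _; rewrite ltn_ord. Qed.

(** The norm of a - one_trunc a N is the tail of the convergent series of
    moduli of a. *)
Lemma one_trunc_approx (a : ell_one R) (e : R) : 0 < e ->
  exists N, rnorm (a - one_trunc a N) <= e.
Proof.
move=> e0; pose s := series (fun n => rnorm (a n)).
have /cvgrPdist_le /(_ _ e0)[N _ /(_ N (leqnn N))] := @sumnorm_cvg _ a.
rewrite -/s -[limn _]/(sumnorm a) => Ne; exists N.
rewrite (le_trans _ Ne)// (le_trans _ (ler_norm _))//.
apply: limr_le; first exact: sumnorm_cvg.
apply: nearW => m; rewrite lerBrDr.
have nd : nondecreasing_seq s.
  by apply: nondecreasing_series => k _ _; exact: rnorm_ge0.
rewrite (le_trans _ (nondecreasing_cvgn_le nd (@sumnorm_cvg _ a) (maxn m N)))//.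
have -> : s N = series (fun n => rnorm (one_trunc a N n)) (maxn m N).
  rewrite /s /series /= (big_cat_nat (leq0n N) (leq_maxr m N)) /=.
  rewrite [X in _ + X]big_nat_cond [X in _ + X]big1 ?addr0//.
    by rewrite !big_mkord; apply: eq_bigr => n _; rewrite ltn_ord.
  by move=> n; rewrite andbT leqNgt => /andP[/negbTE-> _]; rewrite rnorm0.
have mono : series (fun n => rnorm ((a - one_trunc a N) n)) m <=
    series (fun n => rnorm ((a - one_trunc a N) n)) (maxn m N).
  apply: nondecreasing_series (leq_maxl _ _) => k _ _; exact: rnorm_ge0.
rewrite (le_trans (lerD mono (lexx _)))//.
rewrite /s /series /= -big_split /=; apply: ler_sum => n _.
rewrite -[(_ - _) n]/(a n - (if (n < N)%N then a n else 0)).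
by case: ifP => _; rewrite ?subrr ?subr0 rnorm0 ?add0r ?addr0.
Qed.

End SequenceSpaces.

(** * Spaces whose dual is isomorphic to the summable sequences *)

Section Predual.
Context {R : realType} (X : normedModType R[i]).
Context (f : bop (dual X) (ell_one R)) (g : bop (ell_one R) (dual X)).
Hypotheses (fK : cancel f g) (gK : cancel g f).

Definition unit_dual n : dual X := g (one_unit n).

Local Notation phi := unit_dual.

Definition predual_const : R := rnorm f + 1.

Lemma predual_const_gt0 : 0 < predual_const.
Proof. by rewrite ltr_wpDl// rnorm_ge0. Qed.

Lemma unit_dual_dense (psi : dual X) (e : R) : 0 < e ->
  exists (N : nat) (c : nat -> R[i]), rnorm (psi - \sum_(n < N) c n *: phi n) <= e.
Proof.
move=> e0; have g0 : 0 < rnorm g + 1 by rewrite ltr_wpDl// rnorm_ge0.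
have [N Ne] := one_trunc_approx (f psi) (divr_gt0 e0 g0).
exists N, (f psi); rewrite -[psi in psi - _]fK.
have -> : \sum_(n < N) f psi n *: phi n = g (one_trunc (f psi) N).
  by rewrite one_truncE linear_sum; apply: eq_bigr => n _; rewrite linearZ.
rewrite -linearB (le_trans (le_rnorm_bop _ _))//.
rewrite (le_trans (ler_wpM2l (rnorm_ge0 _) Ne))//.
by rewrite mulrA ler_pdivrMr// mulrC ler_pM2l// lerDl.
Qed.

(** By density of the span of the unit functionals.  This is what makes the
    action of a bounded sequence on the dual of X unique, hence linear in the
    sequence. *)
Lemma bidual_determined (G : dual X -> R[i]) (K : R) :
    (forall (k : R[i]) x y, G (k *: x + y) = k * G x + G y) ->
    (forall psi, modulus (G psi) <= K * rnorm psi) ->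
    (forall n, G (phi n) = 0) -> forall psi, G psi = 0.
Proof.
move=> Glin GK G0 psi.
have G00 : G 0 = 0 by have := Glin (-1) 0 0; rewrite scaler0 addr0 mulN1r addNr.
have Gsum N (c : nat -> R[i]) : G (\sum_(n < N) c n *: phi n) = 0.
  elim: N => [|N IH]; first by rewrite big_ord0.
  by rewrite big_ord_recr /= addrC Glin G0 mulr0 IH addr0.
apply: modulus_eq0; apply/eqP; rewrite eq_le modulus_ge0 andbT.
apply/ler_addgt0Pr => e e0; rewrite add0r.
have K0 : 0 < `|K| + 1 by rewrite ltr_wpDl.
have [N [c Nc]] := unit_dual_dense psi (divr_gt0 e0 K0).
have -> : G psi = G (psi - \sum_(n < N) c n *: phi n).
  by rewrite -scaleN1r addrC Glin Gsum mulr0 add0r.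
rewrite (le_trans (GK _))// (@le_trans _ _ (`|K| * (e / (`|K| + 1))))//.
  rewrite (@le_trans _ _ (`|K| * rnorm (psi - \sum_(n < N) c n *: phi n)))//.
    by rewrite ler_wpM2r ?rnorm_ge0// ler_norm.
  by rewrite ler_wpM2l.
by rewrite mulrA ler_pdivrMr// mulrC ler_pM2l// lerDl.
Qed.

(** Functionals separate points, and evaluation at a point is determined by its
    values at the unit functionals. *)
Lemma unit_dual_total x y : (forall n, phi n x = phi n y) -> x = y.
Proof.
move=> xy; apply: dual_separates => psi; apply/eqP; rewrite -subr_eq0; apply/eqP.
pose G (psi : dual X) : R[i] := psi x - psi y.
apply: (@bidual_determined G (rnorm x + rnorm y)).
- move=> k p q; rewrite /G !bopDE !bopZE.
  by rewrite mulrBr opprD addrACA.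
- move=> p; rewrite /G (le_trans (modulusD _ _))// modulusN mulrDl.
  by rewrite lerD// mulrC modulus_dual.
- by move=> n; rewrite /G xy subrr.
Qed.

(** Along a bounded sequence, convergence to zero passes from a set of
    functionals to the closure of its span. *)
Lemma unit_dual_null (z : nat -> X) (M : R) :
    (forall m, rnorm (z m) <= M) ->
    (forall n e, 0 < e -> exists N, forall m, (N <= m)%N ->
       modulus (phi n (z m)) < e) ->
  forall (psi : dual X) e, 0 < e -> exists N, forall m, (N <= m)%N ->
    modulus (psi (z m)) < e.
Proof.
move=> zM z0 psi e e0.
have M0 : 0 < M + 1 by rewrite ltr_wpDl// (le_trans _ (zM 0)) ?rnorm_ge0.
have e2 : 0 < e / 2 by rewrite divr_gt0.
have [n [c nc]] := unit_dual_dense psi (divr_gt0 e2 M0).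
suff [N Ne] : exists N, forall m, (N <= m)%N ->
    modulus ((\sum_(j < n) c j *: phi j : dual X) (z m)) < e / 2.
  exists N => m Nm.
  have -> : psi (z m) = (psi - \sum_(j < n) c j *: phi j : dual X) (z m) +
      (\sum_(j < n) c j *: phi j : dual X) (z m) by rewrite -bopDE subrK.
  rewrite (le_lt_trans (modulusD _ _))// [ltRHS]splitr ler_ltD ?Ne//.
  rewrite (le_trans (modulus_dual _ _))//.
  rewrite (le_trans (ler_wpM2r (rnorm_ge0 _) nc))//.
  rewrite mulrAC ler_pdivrMr// ler_pM2l//.
  by rewrite (le_trans (zM m))// lerDl.
elim: n {nc} (e / 2) e2 => [d d0|n IH d d0].
  by exists 0 => m _; rewrite big_ord0 modulus0.
have d2 : 0 < d / 2 by rewrite divr_gt0.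
have [N Nd] := IH _ d2.
have c0 : 0 < modulus (c n) + 1 by rewrite ltr_wpDl// modulus_ge0.
have [N' Nd'] := z0 n _ (divr_gt0 d2 c0).
exists (maxn N N') => m; rewrite geq_max => /andP[Nm Nm'].
rewrite big_ord_recr bopDE (le_lt_trans (modulusD _ _))// [ltRHS]splitr.
apply: ltr_leD; first exact: Nd.
rewrite bopZE modulusM.
have := Nd' _ Nm'; rewrite ltr_pdivlMr// => /ltW; apply: le_trans.
by rewrite mulrC ler_wpM2l ?modulus_ge0// lerDl.
Qed.

(** Helly's theorem: finitely many coordinates of a bounded sequence are, up to
    a small error, the values of the functionals at a vector of controlled
    norm.  The least value of the norm of x plus a large multiple of the error
    is a seminorm of the coordinates; the functional that Hahn-Banach gives
    for it is a combination of the coordinates whose coefficients have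
    absolute sum at most the norm of f. *)
Lemma helly (F : ell_infty R) (m : nat) (L : R) : 0 < L ->
  exists x, rnorm x <= predual_const * rnorm F /\
    forall n, (n < m)%N -> L * modulus (F n - phi n x) <= predual_const * rnorm F.
Proof.
move=> L0; have [->|F0] := eqVneq F 0.
  exists 0; rewrite !rnorm0 mulr0; split=> // n _.
  by rewrite linear0 subr0 modulus0 mulr0.
pose q (h : 'rV[R[i]]_m) x := rnorm x + L * \sum_(j < m) modulus (h 0 j - phi j x).
have q_ge0 h x : 0 <= q h x.
  rewrite addr_ge0 ?rnorm_ge0// mulr_ge0 ?(ltW L0)// sumr_ge0// => j _.
  exact: modulus_ge0.
have supq h : has_inf (range (q h)).
  by split; [exists (q h 0), 0|exists 0 => _ [x _ <-]].
pose p h := inf (range (q h)).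
have p_le h x : p h <= q h x by apply: ge_inf; [case: (supq h)|exists x].
have le_p h (M : R) : (forall x, M <= q h x) -> M <= p h.
  by move=> Mq; apply: lb_le_inf; [case: (supq h)|move=> _ [x _ <-]].
have pD h h' : p (h + h') <= p h + p h'.
  rewrite -lerBlDl; apply: (le_p h') => y.
  rewrite lerBlDl -lerBlDr; apply: (le_p h) => x.
  rewrite lerBlDr (le_trans (p_le _ (x + y)))// /q addrACA -mulrDr lerD ?rnormD//.
  rewrite ler_pM2l// -big_split /=; apply: ler_sum => j _.
  rewrite mxE linearD (le_trans _ (modulusD _ _))//.
  by rewrite opprD addrACA.
have qZ (k : R[i]) h x : q (k *: h) (k *: x) = modulus k * q h x.
  rewrite /q rnormZ mulrDr; congr (_ + _); rewrite mulrCA; congr (_ * _).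
  rewrite big_distrr /=; apply: eq_bigr => j _.
  by rewrite mxE linearZ -modulusM mulrBr.
have pZle (k : R[i]) h : p (k *: h) <= modulus k * p h.
  have [->|k0] := eqVneq k 0.
    rewrite modulus0 mul0r scale0r (le_trans (p_le _ 0))// /q rnorm0 add0r.
    by rewrite big1 ?mulr0// => j _; rewrite mxE linear0 subrr modulus0.
  rewrite -ler_pdivrMl ?modulus_gt0//; apply: le_p => x.
  by rewrite ler_pdivrMl ?modulus_gt0// -qZ.
have pZ (k : R[i]) h : p (k *: h) = modulus k * p h.
  apply/eqP; rewrite eq_le pZle /=.
  have [->|k0] := eqVneq k 0.
    by rewrite modulus0 mul0r; apply: le_p => x; exact: q_ge0.
  rewrite -ler_pdivlMl ?modulus_gt0//.
  have -> : (modulus k)^-1 = modulus k^-1.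
    apply: (mulfI (_ : modulus k != 0)); first by rewrite gt_eqF ?modulus_gt0.
    by rewrite -modulusM !mulfV ?modulus1// gt_eqF// modulus_gt0.
  by rewrite -[X in p X <= _](scalerK k0); exact: pZle.
pose h := \row_j F (nat_of_ord j) : 'rV[R[i]]_m.
have [l [llin lp lh]] := hahn_banach pD pZ h.
have llin0 : l 0 = 0 by have := llin (-1) 0 0; rewrite scaler0 addr0 mulN1r addNr.
have lsum n (c : 'I_n -> R[i]) (v : 'I_n -> 'rV[R[i]]_m) :
    l (\sum_(j < n) c j *: v j) = \sum_(j < n) c j * l (v j).
  elim: n c v => [|n IH] c v; first by rewrite !big_ord0.
  by rewrite !big_ord_recl llin IH.
pose a n := oapp (fun j => l (delta_mx 0 j)) 0 (insub n : option 'I_m).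
have aE (j : 'I_m) : a j = l (delta_mx 0 j) by rewrite /a valK.
have lE (v : 'rV[R[i]]_m) : l v = \sum_(j < m) v 0 j * a j.
  by rewrite {1}(row_sum_delta v) lsum; apply: eq_bigr => j _; rewrite aE.
pose psi : dual X := \sum_(j < m) a j *: phi j.
have psiE x : psi x = l (\row_j phi (nat_of_ord j) x).
  rewrite lE /psi; under [RHS]eq_bigr do rewrite mxE mulrC.
  elim: (m) => [|n IH]; first by rewrite !big_ord0.
  by rewrite !big_ord_recr bopDE IH bopZE.
have psi1 : rnorm psi <= 1.
  apply: norming_functional_le1 => x; rewrite psiE (le_trans (lp _))//.
  rewrite (le_trans (p_le _ x))// /q big1 ?mulr0 ?addr0// => j _.
  by rewrite mxE subrr modulus0.
have a1 : \sum_(j < m) modulus (a j) <= rnorm f.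
  rewrite -rnorm_one_trunc.
  have -> : one_trunc a m = f psi.
    rewrite one_truncE /psi linear_sum; apply: eq_bigr => j _.
    by rewrite linearZ /= /unit_dual gK.
  rewrite (le_trans (le_rnorm_bop _ _))//.
  by rewrite ler_piMr ?rnorm_ge0.
have phF : p h < predual_const * rnorm F.
  apply: (@le_lt_trans _ _ (rnorm f * rnorm F)); last first.
    by rewrite ltr_pM2r ?rnorm_gt0// ltrDl.
  have -> : p h = modulus (l h).
    by rewrite lh modulusR ger0_norm//; apply: le_p => x; exact: q_ge0.
  rewrite lE; apply: (@le_trans _ _ (\sum_(j < m) modulus (a j) * rnorm F)).
    elim/big_ind2: _ => //; first by rewrite modulus0.
      by move=> x x' y y' xx yy; rewrite (le_trans (modulusD _ _))// lerD.
    move=> j _; rewrite mxE modulusM mulrC ler_wpM2l ?modulus_ge0//.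
    exact: modulus_le_infty.
  by rewrite -mulr_suml ler_wpM2r ?rnorm_ge0.
have [_ [x _ <-] qx] := inf_lt (supq h).1 phF.
exists x; split.
  rewrite (le_trans _ (ltW qx))// /q lerDl mulr_ge0 ?(ltW L0)// sumr_ge0// => j _.
  exact: modulus_ge0.
move=> n nm; rewrite (le_trans _ (ltW qx))// /q.
rewrite (@le_trans _ _ (L * \sum_(j < m) modulus (h 0 j - phi j x)))//.
  rewrite ler_pM2l// (bigD1 (Ordinal nm)) //= mxE lerDl sumr_ge0// => j _.
  exact: modulus_ge0.
by rewrite lerDr rnorm_ge0.
Qed.

Lemma bidual_approx (F : ell_infty R) : exists x : nat -> X,
  (forall m, rnorm (x m) <= predual_const * rnorm F) /\
  forall n (e : R), 0 < e -> exists N, forall m, (N <= m)%N ->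
    modulus (phi n (x m) - F n) < e.
Proof.
have [x xP] := choice (fun m => helly F m (ltr0Sn R m)).
exists x; split=> [m|n e e0]; first by have [] := xP m.
pose C := predual_const * rnorm F.
have C0 : 0 <= C by rewrite mulr_ge0 ?rnorm_ge0// ltW// predual_const_gt0.
exists (maxn n.+1 (Num.truncn (C / e))) => m; rewrite geq_max => /andP[nm Nm].
have [_ /(_ n nm)] := xP m; rewrite modulusB -/C => h.
have : C < m.+1%:R * e.
  rewrite -ltr_pdivrMr// (lt_le_trans (truncnS_gt _))// ler_nat ltnS.
  exact: Nm.
by move/(le_lt_trans h); rewrite ltr_pM2l.
Qed.

End Predual.

(** * Extending operators to all bounded sequences *)

Section Extension.
Context {R : realType} (X : normedModType R[i]).
Context (f : bop (dual X) (ell_one R)) (g : bop (ell_one R) (dual X)).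
Hypotheses (fK : cancel f g) (gK : cancel g f).

Local Notation phi := (unit_dual g).
Local Notation C := (predual_const f).

(** A bounded sequence F acts on the dual of X as the limit, along an
    ultrafilter, of evaluations at vectors approximating F.  The adjoint of a
    compact operator T turns this into an evaluation at an actual vector,
    because the images under T of the approximating vectors converge. *)
Lemma bidual_functional (F : ell_infty R) : exists G : dual X -> R[i],
  [/\ forall (k : R[i]) p q, G (k *: p + q) = k * G p + G q,
      forall psi, modulus (G psi) <= C * rnorm F * rnorm psi,
      forall n, G (phi n) = F n
    & forall T : bop X X, compact_op T ->
        exists y, forall psi : dual X, psi y = G (bop_comp psi T)].
Proof.
have [x [xC xF]] := bidual_approx gK F.
have [U [UU Uinf]] := free_ultrafilter.
have psix (psi : dual X) m : modulus (psi (x m)) <= C * rnorm F * rnorm psi.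
  rewrite (le_trans (modulus_dual _ _))// mulrC.
  by rewrite ler_wpM2r ?rnorm_ge0.
have [G GP] := choice (fun psi : dual X => ulim_exists (FU := UU) (psix psi)).
exists G; split=> [k p q|psi|n|T cT].
- apply: ulim_unique (GP _) _.
  exact: ulim_linear (GP p) (GP q).
- exact: ulim_le (psix psi) (GP psi).
- apply: ulim_unique (GP _) _ => e e0; have [N Ne] := xF n e e0.
  by apply: filterS (Uinf N) => m /=; exact: Ne.
- have [y yP] := compact_op_ultra UU cT xC; exists y => psi.
  apply/esym; apply: ulim_unique (GP _) _ => e e0.
  have p0 : 0 < rnorm psi + 1 by rewrite ltr_wpDl// rnorm_ge0.
  apply: filterS (yP _ (divr_gt0 e0 p0)) => m /=.
  rewrite ltr_pdivlMr// => h.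
  have -> : bop_comp psi T (x m) - psi y = psi (T (x m) - y) by rewrite linearB.
  rewrite (le_lt_trans (modulus_dual _ _))//.
  by rewrite (le_lt_trans _ h)// mulrC ler_wpM2l ?rnorm_ge0// lerDl.
Qed.

Let bidual_eq (G G' : dual X -> R[i]) (K K' : R) :
    (forall (k : R[i]) p q, G (k *: p + q) = k * G p + G q) ->
    (forall (k : R[i]) p q, G' (k *: p + q) = k * G' p + G' q) ->
    (forall psi, modulus (G psi) <= K * rnorm psi) ->
    (forall psi, modulus (G' psi) <= K' * rnorm psi) ->
  (forall n, G (phi n) = G' (phi n)) -> G =1 G'.
Proof.
move=> Glin G'lin GK G'K GG' psi; apply/eqP; rewrite -subr_eq0; apply/eqP.
apply: (@bidual_determined _ _ _ _ fK (fun p => G p - G' p) (K + K')).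
- by move=> k p q; rewrite Glin G'lin mulrBr opprD addrACA.
- move=> p; rewrite (le_trans (modulusD _ _))// modulusN mulrDl.
  exact: lerD.
- by move=> n; rewrite GG' subrr.
Qed.

Definition coordinates_spec (U : bop X (ell_infty R)) :=
  forall x n, U x n = phi n x.

Lemma coordinates_exists : exists U, coordinates_spec U.
Proof.
apply: (@infty_bop _ _ (fun n x => phi n x) (rnorm g)) => [n k x y|n x].
  by rewrite linearP.
rewrite (le_trans (modulus_dual _ _))// ler_wpM2r ?rnorm_ge0//.
rewrite (le_trans (le_rnorm_bop _ _))// ler_piMr ?rnorm_ge0//.
rewrite rnorm_one_trunc big_ord_recr /= eqxx modulus1 big1 ?add0r//.
by move=> j _; rewrite ltn_eqF ?modulus0//.
Qed.

Let Gamma := projT1 (choice bidual_functional).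

Let Gamma_lin F (k : R[i]) p q :
  Gamma F (k *: p + q) = k * Gamma F p + Gamma F q.
Proof. by have [] := projT2 (choice bidual_functional) F. Qed.

Let Gamma_le F psi : modulus (Gamma F psi) <= C * rnorm F * rnorm psi.
Proof. by have [] := projT2 (choice bidual_functional) F. Qed.

Let Gamma_phi F n : Gamma F (phi n) = F n.
Proof. by have [] := projT2 (choice bidual_functional) F. Qed.

Let Gamma_compact F (T : bop X X) : compact_op T ->
  exists y, forall psi : dual X, psi y = Gamma F (bop_comp psi T).
Proof. by have [_ _ _] := projT2 (choice bidual_functional) F; exact. Qed.

Let GammaP (k : R[i]) F F' psi :
  Gamma (k *: F + F') psi = k * Gamma F psi + Gamma F' psi.
Proof.
apply: (bidual_eq (G' := fun p => k * Gamma F p + Gamma F' p)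
  (K' := modulus k * (C * rnorm F) + C * rnorm F')
  (@Gamma_lin _) _ (@Gamma_le _)) => [c p q|p|n].
- rewrite !Gamma_lin !mulrDr !mulrA (mulrC k c) -!addrA; congr (_ + _).
  by rewrite addrCA.
- rewrite (le_trans (modulusD _ _))// mulrDl modulusM -mulrA lerD//.
  by rewrite ler_wpM2l ?modulus_ge0.
- by rewrite !Gamma_phi.
Qed.

Let Gamma_coordinates U x psi : coordinates_spec U -> Gamma (U x) psi = psi x.
Proof.
move=> Ux; apply: (bidual_eq (G' := fun p : dual X => p x) (K' := rnorm x)
  (@Gamma_lin _) _ (@Gamma_le _)) => [//|p|n].
  by rewrite mulrC modulus_dual.
by rewrite Gamma_phi Ux.
Qed.

(** The n-th coordinate of T is a functional on X, on which every bounded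
    sequence acts. *)
Lemma extension_infty (U T : bop X (ell_infty R)) : coordinates_spec U ->
  exists S : bop (ell_infty R) (ell_infty R), forall x, S (U x) = T x.
Proof.
move=> Ux; have [ev evP] := choice (@infty_ev R).
have [||S SE] := @infty_bop _ (ell_infty R)
  (fun n F => Gamma F (bop_comp (ev n) T)) (C * rnorm T).
- by move=> n k F F'; exact: GammaP.
- move=> n F; rewrite (le_trans (Gamma_le _ _))// mulrAC ler_wpM2r ?rnorm_ge0//.
  rewrite ler_pM2l ?predual_const_gt0//; apply: rnorm_bop_le => [|x].
    exact: rnorm_ge0.
  rewrite -[X in X <= _]/(modulus (ev n (T x))) (evP n).1.
  by rewrite (le_trans (modulus_le_infty _ _))// le_rnorm_bop.
exists S => x; apply: infty_ext => n; rewrite SE Gamma_coordinates//.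
by rewrite -[LHS]/(ev n (T x)) (evP n).1.
Qed.

(** The vector that represents the action of F composed with T is unique, so it
    depends linearly on F; a norming functional bounds it. *)
Lemma extension_compact (U : bop X (ell_infty R)) (T : bop X X) :
    coordinates_spec U -> compact_op T ->
  exists S : bop (ell_infty R) X, forall x, S (U x) = T x.
Proof.
move=> Ux cT; have [s sP] := choice (fun F => Gamma_compact F cT).
have [||S SE] := @bounded_linear_bop _ (ell_infty R) X s (C * rnorm T).
- move=> k F F'; apply: dual_separates => psi.
  rewrite linearP; apply: (etrans (sP _ _)); rewrite GammaP.
  by congr (_ * _ + _); apply/esym; exact: sP.
- move=> F; have [psi [psi1 psis]] := norming_functional (s F).
  have -> : rnorm (s F) = modulus (psi (s F)).
    by rewrite psis modulusR ger0_norm ?rnorm_ge0.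
  rewrite (_ : psi (s F) = Gamma F (bop_comp psi T)); last exact: sP.
  rewrite (le_trans (Gamma_le _ _))// mulrAC ler_wpM2r ?rnorm_ge0//.
  rewrite ler_pM2l ?predual_const_gt0//; apply: rnorm_bop_le => [|x].
    exact: rnorm_ge0.
  rewrite -[X in X <= _]/(modulus (psi (T x))) (le_trans (psi1 _))//.
  exact: le_rnorm_bop.
exists S => x; apply: dual_separates => psi.
by rewrite SE; apply: (etrans (sP _ _)); exact: Gamma_coordinates.
Qed.

End Extension.

(** * Weakly null sequences *)

Section WeaklyNull.
Context {R : realType} (X : normedModType R[i]).

Definition weakly_null (z : nat -> X) : Prop :=
  forall (psi : dual X) (e : R), 0 < e ->
    exists N, forall m, (N <= m)%N -> modulus (psi (z m)) < e.

(** Each further functional costs one dimension: if it is nonzero at a vector u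
    of the kernel of the previous ones, then a vector of that kernel outside the
    span of e and u can be corrected by a multiple of u.  The list e is what
    makes this induction go through. *)
Lemma infinite_dimensional_kernel (phi : nat -> dual X) (m : nat) :
    infinite_dimensional X -> forall n (e : 'I_n -> X),
  exists x, (forall k, (k < m)%N -> phi k x = 0) /\
    forall a : 'I_n -> R[i], x <> \sum_(i < n) a i *: e i.
Proof.
move=> infX; elim: m => [n e|m IH n e].
  by have [x xP] := infX n e; exists x.
have [[u [u0 um]]|Nu] := pselect (exists u,
    (forall k, (k < m)%N -> phi k u = 0) /\ phi m u != 0); last first.
  have [x [x0 xe]] := IH n e; exists x; split=> // k.
  rewrite ltnS leq_eqVlt => /predU1P[->|]; last exact: x0.
  by apply/eqP; apply: contrapT => /negP xm; apply: Nu; exists x.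
have [x [x0 xe]] := IH n.+1 (fun i => oapp e u (unlift ord0 i)).
pose t : R[i] := phi m x / phi m u.
exists (x - t *: u); split=> [k|a xa].
  rewrite ltnS leq_eqVlt => /predU1P[->|km]; rewrite linearB linearZ /=.
    by rewrite /t -[_ *: _]/(phi m x / phi m u * phi m u) divfK// subrr.
  by rewrite x0// u0// scaler0 subrr.
apply: (xe (fun i => oapp a t (unlift ord0 i))).
rewrite big_ord_recl /= unlift_none /= -[LHS](subrK (t *: u)) xa addrC.
by congr (_ + _); apply: eq_bigr => i _; rewrite !liftK.
Qed.

(** Take z m annihilated by the first m unit functionals: then every unit
    functional is eventually zero on z. *)
Lemma weakly_null_unit_sequence (f : bop (dual X) (ell_one R))
    (g : bop (ell_one R) (dual X)) :
    cancel f g -> infinite_dimensional X ->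
  exists z, (forall m, rnorm (z m) = 1) /\ weakly_null z.
Proof.
move=> fK infX.
have zP m : exists z, rnorm z = 1 /\ forall k, (k < m)%N -> unit_dual g k z = 0.
  have [x [x0 xe]] := infinite_dimensional_kernel (unit_dual g) m infX
    (fun _ : 'I_0 => 0).
  have xn0 : 0 < rnorm x.
    apply: rnorm_gt0; apply/eqP => x00; apply: (xe (fun=> 0)).
    by rewrite big_ord0.
  exists ((rnorm x)^-1%:C *: x); split=> [|k km].
    by rewrite rnormZr gtr0_norm ?invr_gt0// mulVf// gt_eqF.
  by rewrite linearZ /= x0// scaler0.
have [z {}zP] := choice zP.
exists z; split=> [m|]; first by case: (zP m).
apply: (unit_dual_null fK (M := 1)) => [m|n e e0]; first by case: (zP m) => ->.
exists n.+1 => m nm; case: (zP m) => _ /(_ n nm) ->.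
by rewrite modulus0.
Qed.

(** A limit of T (z m) along an ultrafilter exists by compactness, and every
    functional vanishes at it. *)
Lemma compact_op_weakly_null (T : bop X X) (z : nat -> X) (M : R) :
    compact_op T -> (forall m, rnorm (z m) <= M) -> weakly_null z ->
  forall N (e : R), 0 < e -> exists m, (N <= m)%N /\ rnorm (T (z m)) < e.
Proof.
move=> cT zM z0 N e e0.
have [U [UU Uinf]] := free_ultrafilter.
have [y yP] := compact_op_ultra UU cT zM.
suff y0 : y = 0.
  have [m [/= mN]] := filter_ex (filterI (Uinf N) (yP _ e0)).
  by rewrite y0 subr0; exists m.
apply: dual_separates => psi; rewrite linear0; apply: modulus_eq0.
apply/eqP; rewrite eq_le modulus_ge0 andbT; apply/ler_addgt0Pr => d d0.
rewrite add0r; have d2 : 0 < d / 2 by rewrite divr_gt0.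
have [k kP] := z0 (bop_comp psi T) _ d2.
have p0 : 0 < rnorm psi + 1 by rewrite ltr_wpDl// rnorm_ge0.
have [m [/= km ym]] := filter_ex (filterI (Uinf k) (yP _ (divr_gt0 d2 p0))).
have -> : psi y = psi (T (z m)) - psi (T (z m) - y).
  by rewrite linearB /= opprB addrCA subrr addr0.
rewrite (le_trans (modulusD _ _))// modulusN [leRHS]splitr lerD//.
  exact/ltW/kP.
rewrite (le_trans (modulus_dual _ _))//.
rewrite (le_trans (ler_wpM2l (rnorm_ge0 _) (ltW ym)))//.
by rewrite mulrA ler_pdivrMr// mulrC ler_pM2l// lerDl.
Qed.

End WeaklyNull.

(** * Separability *)

Section Separable.
Context {R : realType} (X : normedModType R[i]).

Definition separable : Prop :=
  exists (T : countType) (D : T -> X),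
    forall x (e : R), 0 < e -> exists t, rnorm (x - D t) < e.

Let cplx (q : rat * rat) : R[i] := ratr q.1 +i* ratr q.2.

Let cplx_dense (c : R[i]) (e : R) : 0 < e -> exists q, modulus (c - cplx q) < e.
Proof.
move=> e0; have e2 : 0 < e / 2 by rewrite divr_gt0.
have real_dense (a : R) : exists q : rat, `|a - ratr q| < e / 2.
  have lt_a : a - e / 2 < a + e / 2 by rewrite ltrBlDr -addrA ltrDl addr_gt0.
  have [q] := rat_in_itvoo lt_a; rewrite in_itv /= => /andP[qa aq].
  by exists q; rewrite distrC ltr_distl qa.
case: c => a b; have [p pa] := real_dense a; have [q qb] := real_dense b.
exists (p, q); rewrite (le_lt_trans (modulus_le_ReIm _))// [ltRHS]splitr.
exact: ltrD.
Qed.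

(** Partial sums of basis expansions are approximated by combinations with
    coefficients in Q[i], which form a countable set. *)
Lemma schauder_basis_separable : has_schauder_basis X -> separable.
Proof.
move=> [b bP]; pose D (s : seq (rat * rat)) : X :=
  \sum_(n < size s) cplx (nth (0, 0) s n) *: b n.
exists (seq (rat * rat) : countType), D => x e e0.
have Drcons s q : D (rcons s q) = D s + cplx q *: b (size s).
  rewrite /D size_rcons big_ord_recr /= nth_rcons ltnn eqxx; congr (_ + _).
  by apply: eq_bigr => i _; rewrite nth_rcons ltn_ord.
have approx (a : nat -> R[i]) N d : 0 < d -> exists s, size s = N /\
    rnorm (\sum_(n < N) a n *: b n - D s) < d.
  elim: N d => [|N IH] d d0.
    by exists [::]; rewrite /D !big_ord0 subrr rnorm0.
  have d2 : 0 < d / 2 by rewrite divr_gt0.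
  have [s [sN sd]] := IH _ d2.
  have b0 : 0 < rnorm (b N) + 1 by rewrite ltr_wpDl// rnorm_ge0.
  have [q] := cplx_dense (a N) (divr_gt0 d2 b0).
  rewrite ltr_pdivlMr// => qd; exists (rcons s q); split.
    by rewrite size_rcons sN.
  rewrite big_ord_recr /= Drcons sN opprD addrACA -scalerBl.
  rewrite (le_lt_trans (rnormD _ _))// [ltRHS]splitr ltrD//.
  rewrite rnormZ (le_lt_trans _ qd)// ler_wpM2l ?modulus_ge0//.
  by rewrite lerDl.
have [a [ax _]] := bP x; have e2 : 0 < e / 2 by rewrite divr_gt0.
have e2C : (0 : R[i]) < (e / 2)%:C by rewrite ltcR.
have /cvgrPdist_lt /(_ _ e2C)[N _ /(_ N (leqnn N))] := ax.
rewrite /= -rnormE ltcR => xN.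
have [s [_ sd]] := approx a N _ e2.
exists s; rewrite -[x](subrK (series (fun n => a n *: b n) N)) -addrA.
rewrite (le_lt_trans (rnormD _ _))// [ltRHS]splitr ltrD//.
by rewrite /series /= big_mkord.
Qed.

(** Approximating each v B by a member of a countable dense set would give an
    injection of the power set into the natural numbers. *)
Lemma separable_no_separated_powerset (v : set nat -> X) (d : R) :
    separable -> 0 < d ->
  ~ forall B B', B <> B' -> d <= rnorm (v B - v B').
Proof.
move=> [T [D DP]] d0 vd; have d2 : 0 < d / 2 by rewrite divr_gt0.
have [t tP] := choice (fun B => DP (v B) _ d2).
have tinj B B' : t B = t B' -> B = B'.
  move=> tt; apply: contrapT => /vd; apply/negP; rewrite -ltNge.
  rewrite -[v B](subrK (D (t B))) -addrA (le_lt_trans (rnormD _ _))//.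
  rewrite [ltRHS]splitr; apply: ltrD; first exact: tP.
  by rewrite rnormB tt; exact: tP.
(* Cantor's diagonal set *)
pose B := [set n | exists B', pickle (t B') = n /\ ~ B' n].
have BN : B (pickle (t B)) -> ~ B (pickle (t B)).
  by move=> [B' [/(pcan_inj pickleK)/tinj ->]].
have nB : ~ B (pickle (t B)) by move=> h; exact: (BN h).
by apply: (nB); exists B.
Qed.

End Separable.

(** * Operators on disjointly supported sequences *)

(** Rosenthal's disjointification lemma.  Split the indices into infinitely
    many infinite classes.  If no class works, each contains a bad index; the
    bad indices form a family that is disjoint from what makes each of them
    bad, so superadditivity lowers the bound on that family by e. *)
Lemma rosenthal {R : realType} (v : nat -> set nat -> R) (e M : R) :
    0 < e ->
    (forall k E, 0 <= v k E <= M) ->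
    (forall k E F, E `<=` F -> v k E <= v k F) ->
    (forall k E F, E `&` F = set0 -> v k E + v k F <= v k (E `|` F)) ->
  exists i : nat -> nat, injective i /\
    forall k, v (i k) (range i `\ i k) < e.
Proof.
move=> e0 vM vS vU.
suff IH n : forall j : nat -> nat, injective j ->
    (forall k, v (j k) (range j) < n%:R * e) ->
    exists i : nat -> nat, injective i /\ forall k, v (i k) (range i `\ i k) < e.
  apply: (IH (Num.truncn (M / e)).+1 id) => // k.
  have /andP[_ /le_lt_trans] := vM (id k) (range id); apply.
  by rewrite -ltr_pdivrMr// truncnS_gt.
elim: n => [j _ /(_ 0)|n IH j jinj jv].
  by rewrite mul0r ltNge; have /andP[-> _] := vM (j 0) (range j).
pose h (p q : nat) := j (pickle (p, q)).
have hinj p q p' q' : h p q = h p' q' -> p = p' /\ q = q'.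
  by move=> /jinj /(pcan_inj pickleK)[].
have [[p pP]|bad] := pselect (exists p, forall q,
    v (h p q) (range (h p) `\ h p q) < e).
  by exists (h p); split=> // q q' /hinj[].
have {}bad p : exists q, e <= v (h p q) (range (h p) `\ h p q).
  apply: contrapT => nq; apply: bad; exists p => q.
  by rewrite ltNge; apply/negP => ?; apply: nq; exists q.
have [q qP] := choice bad.
apply: (IH (fun p => h p (q p))) => [p p' /hinj[]//|p].
rewrite -(ltrD2r e) -[X in _ < _ + X]mul1r -mulrDl natr1.
apply: le_lt_trans (jv (pickle (p, q p))).
rewrite (le_trans (lerD (lexx _) (qP p)))// (le_trans (vU _ _ _ _))//.
  apply/seteqP; split=> // _ [[p' _ <-]] [[r _]] /hinj[pp' _]; rewrite -pp'.
  exact.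
apply: vS => _ [[p' _ <-]|[[r _ <-] _]]; first by exists (pickle (p', q p')).
by exists (pickle (p, r)).
Qed.

Section Variation.
Context {R : realType}.
Implicit Types (W : normedModType R[i]) (E F : set nat) (g : ell_infty R).

Definition supported E g : Prop := forall n, ~ E n -> g n = 0.

(** The norm of A on the sequences supported in E.  For a functional A this is
    the total variation on E of the finitely additive measure that A is. *)
Definition opvar W (A : bop (ell_infty R) W) E : R :=
  sup [set rnorm (A g) | g in [set g | rnorm g <= 1 /\ supported E g]].

Section Theory.
Context W (A : bop (ell_infty R) W).

Let opvar_has_sup E :
  has_sup [set rnorm (A g) | g in [set g | rnorm g <= 1 /\ supported E g]].
Proof.
split; first by exists (rnorm (A 0)), 0 => //=; rewrite rnorm0.
exists (rnorm A) => _ [g [g1 _] <-].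
by rewrite (le_trans (le_rnorm_bop _ _))// ler_piMr// rnorm_ge0.
Qed.

Lemma le_opvar E g : rnorm g <= 1 -> supported E g -> rnorm (A g) <= opvar A E.
Proof. by move=> g1 gE; apply: ub_le_sup; [case: (opvar_has_sup E)|exists g]. Qed.

Lemma opvar_le E (M : R) :
  (forall g, rnorm g <= 1 -> supported E g -> rnorm (A g) <= M) ->
  opvar A E <= M.
Proof.
move=> gM; apply: ge_sup; first by case: (opvar_has_sup E).
by move=> _ [g [g1 gE] <-]; exact: gM.
Qed.

Lemma opvar_ge0 E : 0 <= opvar A E.
Proof. by rewrite (le_trans (rnorm_ge0 (A 0)))// le_opvar ?rnorm0. Qed.

Lemma opvar_le_norm E : opvar A E <= rnorm A.
Proof.
apply: opvar_le => g g1 _.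
by rewrite (le_trans (le_rnorm_bop _ _))// ler_piMr// rnorm_ge0.
Qed.

Lemma opvarS E F : E `<=` F -> opvar A E <= opvar A F.
Proof.
move=> EF; apply: opvar_le => g g1 gE; apply: le_opvar => // n nF.
by apply: gE => /EF.
Qed.

Lemma opvar_adherent E (e : R) : 0 < e ->
  exists g, [/\ rnorm g <= 1, supported E g & opvar A E - e < rnorm (A g)].
Proof.
move=> e0; have [_ [g [g1 gE] <-] ge] := sup_adherent e0 (opvar_has_sup E).
by exists g; split.
Qed.

Lemma le_opvarZ E g : supported E g -> rnorm (A g) <= rnorm g * opvar A E.
Proof.
have [->|g0] := eqVneq g 0; first by rewrite linear0 !rnorm0 mul0r.
move=> gE; have ng : 0 < rnorm g by exact: rnorm_gt0.
rewrite -ler_pdivrMl// -[X in X * _]gtr0_norm ?invr_gt0// -rnormZr -linearZ.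
apply: le_opvar => [|n nE].
  by rewrite rnormZr gtr0_norm ?invr_gt0// mulVf ?gt_eqF.
by rewrite -[LHS]/(_ * g n) gE// mulr0.
Qed.

End Theory.

Let cutoff_bound E g n : modulus (if `[< E n >] then g n else 0) <= rnorm g.
Proof. by case: ifP => _; rewrite ?modulus_le_infty// modulus0 rnorm_ge0. Qed.

Definition cutoff E g : ell_infty R := infty_of (cutoff_bound E g).

Lemma cutoffE E g n : cutoff E g n = if `[< E n >] then g n else 0.
Proof. by []. Qed.

Lemma rnorm_cutoff E g : rnorm (cutoff E g) <= rnorm g.
Proof. by apply: rnorm_infty_le => n; exact: cutoff_bound. Qed.

Lemma cutoff_supported E g : supported E (cutoff E g).
Proof. by move=> n nE; rewrite cutoffE asboolF. Qed.

Lemma cutoff_decomp E g : g = cutoff E g + cutoff (~` E) g.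
Proof.
apply: infty_ext => n; rewrite -[RHS]/(cutoff E g n + cutoff (~` E) g n) !cutoffE.
by rewrite asbool_neg; case: asboolP; rewrite ?addr0 ?add0r.
Qed.

Lemma opvarU W (A : bop (ell_infty R) W) E F :
  opvar A (E `|` F) <= opvar A E + opvar A F.
Proof.
apply: opvar_le => g g1 gEF; rewrite {1}(cutoff_decomp E g) linearD.
rewrite (le_trans (rnormD _ _))// lerD// le_opvar ?(le_trans (rnorm_cutoff _ _))//.
  exact: cutoff_supported.
move=> n nF; rewrite cutoffE asbool_neg; case: asboolP => //= nE.
by apply: gEF => -[].
Qed.

(** Nearly extremal sequences for E and for F, rotated so that mu takes
    positive values on both, add up to a sequence of norm at most one. *)
Lemma opvar_superadditive (mu : dual (ell_infty R)) E F : E `&` F = set0 ->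
  opvar mu E + opvar mu F <= opvar mu (E `|` F).
Proof.
move=> EF; apply/ler_addgt0Pr => e e0; have e2 : 0 < e / 2 by rewrite divr_gt0.
have [g [g1 gE ge]] := opvar_adherent mu E e2.
have [h [h1 hF he]] := opvar_adherent mu F e2.
have [u u1 ug] := phaseP (mu g); have [w w1 wh] := phaseP (mu h).
pose k : ell_infty R := u *: g + w *: h.
have kn n : k n = u * g n + w * h n by [].
have k1 : rnorm k <= 1.
  apply: rnorm_infty_le => n; rewrite kn.
  have [En|nE] := pselect (E n).
    have nF : ~ F n by move=> Fn; have : (E `&` F) n by []; rewrite EF.
    by rewrite hF// mulr0 addr0 modulusM u1 mul1r (le_trans (modulus_le_infty _ _)).
  by rewrite gE// mulr0 add0r modulusM w1 mul1r (le_trans (modulus_le_infty _ _)).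
have kEF : supported (E `|` F) k.
  by move=> n nEF; rewrite kn gE ?hF ?mulr0 ?addr0// => ?; apply: nEF; [right|left].
have muk : modulus (mu k) = modulus (mu g) + modulus (mu h).
  have -> : mu k = (modulus (mu g) + modulus (mu h))%:C.
    by rewrite rmorphD /= -ug -wh /k linearP linearZ.
  by rewrite modulusR ger0_norm// addr_ge0// modulus_ge0.
have := le_opvar mu k1 kEF; rewrite -[rnorm (mu k)]/(modulus (mu k)) muk => muEF.
rewrite -lerBlDr (le_trans _ muEF)// [in leLHS](splitr e) opprD addrACA.
by rewrite lerD// ltW.
Qed.

(** If A were bounded below on such a family, Rosenthal's lemma would give a
    subfamily whose sums over different index sets have images at a fixed
    distance from each other. *)
Lemma separable_exhaustive (X : normedModType R[i]) (A : bop (ell_infty R) X)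
    (D : nat -> set nat) (g : nat -> ell_infty R) (d : R) :
    separable X -> 0 < d -> trivIset setT D ->
    (forall j, rnorm (g j) <= 1) -> (forall j, supported (D j) (g j)) ->
  ~ forall j, d <= rnorm (A (g j)).
Proof.
move=> sepX d0 Ddisj g1 gD dA; have d2 : 0 < d / 2 by rewrite divr_gt0.
have [psi psiP] := choice (fun j => norming_functional (A (g j))).
pose mu j : dual (ell_infty R) := bop_comp (psi j) A.
have muE j h : mu j h = psi j (A h) by [].
pose v k (E : set nat) := opvar (mu k) (\bigcup_(j in E) D j).
have Dinj i j n : D i n -> D j n -> i = j.
  by move=> Di Dj; apply: Ddisj => //; exists n.
have [|||i [iinj iP]] := @rosenthal R v (d / 2) (rnorm A) d2.
- move=> k E; rewrite opvar_ge0 (le_trans (opvar_le_norm _ _))//.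
  apply: rnorm_bop_le => [|h]; first exact: rnorm_ge0.
  rewrite -[X in X <= _]/(modulus (psi k (A h))) (le_trans ((psiP k).1 _))//.
  exact: le_rnorm_bop.
- by move=> k E F EF; apply: opvarS; exact: bigcup_subset.
- move=> k E F EF; rewrite /v bigcup_setU; apply: opvar_superadditive.
  apply/seteqP; split=> // n [[j Ej Dj] [l Fl Dl]].
  have jl := Dinj _ _ _ Dj Dl; rewrite -jl in Fl.
  by have : (E `&` F) j by []; rewrite EF.
(* the common value of the g j on their supports *)
have GP n : exists c, modulus c <= 1 /\ forall j, D j n -> g j n = c.
  have [[j Dj]|nD] := pselect (exists j, D j n).
    exists (g j n); split=> [|l Dl]; last by rewrite (Dinj _ _ _ Dj Dl).
    by rewrite (le_trans (modulus_le_infty _ _)).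
  by exists 0; rewrite modulus0; split=> // j Dj; case: nD; exists j.
have [G0 {}GP] := choice GP.
pose G := infty_of (fun n => (GP n).1).
have GE n : G n = G0 n by [].
pose S (B : set nat) := \bigcup_(k in B) D (i k).
apply: (separable_no_separated_powerset (v := fun B => A (cutoff (S B) G)) sepX d2).
suff key B B' k : B k -> ~ B' k ->
    d / 2 <= rnorm (A (cutoff (S B) G) - A (cutoff (S B') G)).
  move=> B B' BB'.
  have [[k [Bk B'k]]|nk] := pselect (exists k, B k /\ ~ B' k).
    exact: key Bk B'k.
  have [[k [B'k Bk]]|nk'] := pselect (exists k, B' k /\ ~ B k).
    by rewrite rnormB; exact: key B'k Bk.
  case: BB'; apply/seteqP; split=> k kB; apply: contrapT => kB'.
    by apply: nk; exists k.
  by apply: nk'; exists k.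
move=> Bk B'k.
pose h : ell_infty R := cutoff (S B) G - cutoff (S B') G - g (i k).
have hn n : h n = (if `[< S B n >] then G n else 0)
    - (if `[< S B' n >] then G n else 0) - g (i k) n by [].
have SP n l : D (i l) n -> forall C : set nat, S C n <-> C l.
  move=> Dl C; split=> [[m Cm Dm]|Cl]; last by exists l.
  by rewrite -(iinj _ _ (Dinj _ _ _ Dm Dl)).
have hD n l : D (i l) n -> l <> k -> g (i k) n = 0.
  by move=> Dl lk; apply: gD => Dk; apply: lk; exact: iinj (Dinj _ _ _ Dl Dk).
have h0 n l : D (i l) n -> l = k -> h n = 0.
  move=> Dl lk; rewrite hn asboolT; last by apply/(SP _ _ Dl); rewrite lk.
  rewrite asboolF; last by move/(SP _ _ Dl); rewrite lk.
  by rewrite lk in Dl; rewrite subr0 ((GP n).2 _ Dl) GE subrr.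
have hsupp : supported (\bigcup_(j in range i `\ i k) D j) h.
  move=> n nS; have [[l Dl]|nD] := pselect (exists l, D (i l) n).
    have [lk|lk] := pselect (l = k); first exact: h0 Dl lk.
    case: nS; exists (i l) => //; split; first by exists l.
    by move=> /iinj.
  rewrite hn !asboolF ?subr0 ?sub0r; first last.
  - by move=> [l _ Dl]; apply: nD; exists l.
  - by move=> [l _ Dl]; apply: nD; exists l.
  by rewrite gD ?oppr0// => Dk; apply: nD; exists k.
have h1 : rnorm h <= 1.
  apply: rnorm_infty_le => n.
  have [[l Dl]|nD] := pselect (exists l, D (i l) n); last first.
    rewrite hsupp ?modulus0// => -[_ [[l _ <-] _] Dl].
    by apply: nD; exists l.
  have [lk|lk] := pselect (l = k); first by rewrite (h0 _ _ Dl lk) modulus0.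
  rewrite hn (hD _ _ Dl lk) subr0.
  case: asboolP => _; case: asboolP => _;
    by rewrite ?subrr ?subr0 ?sub0r ?modulusN ?modulus0 ?GE ?(GP n).1.
have muh : modulus (mu (i k) h) < d / 2.
  exact: le_lt_trans (le_opvar (mu (i k)) h1 hsupp) (iP k).
rewrite (le_trans _ ((psiP (i k)).1 _))//.
have -> : psi (i k) (A (cutoff (S B) G) - A (cutoff (S B') G)) =
    psi (i k) (A (g (i k))) + mu (i k) h.
  rewrite muE -linearD -linearD /h -linearB.
  by congr (psi _ (A _)); rewrite addrCA subrr addr0.
have : modulus (psi (i k) (A (g (i k)))) <=
    modulus (psi (i k) (A (g (i k))) + mu (i k) h) + modulus (mu (i k) h).
  by rewrite -[X in _ <= _ + X]modulusN (le_trans _ (modulusD _ _))// addrK.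
rewrite (psiP (i k)).2 modulusR ger0_norm ?rnorm_ge0//.
have := dA (i k); lra.
Qed.

End Variation.

(** * Operators that factor through the bounded sequences *)

Section Factorization.
Context {R : realType} (X : normedModType R[i]).
Context (A : bop (ell_infty R) X) (B : bop X (ell_infty R)).

(** If no finite union were enough, the successive remainders would form a
    disjoint sequence of sets of large variation. *)
Let finite_union_exhausts (E : nat -> set nat) (n : nat) (d : R) :
    separable X -> 0 < d ->
  exists K, forall m, (n <= m)%N ->
    opvar A (E m `\` \bigcup_(j in [set j | (n <= j < K)%N]) E j) < d.
Proof.
move=> sepX d0; apply: contrapT => nK.
have step K : exists m, (n <= m)%N /\
    d <= opvar A (E m `\` \bigcup_(j in [set j | (n <= j < K)%N]) E j).
  apply: contrapT => nm; apply: nK; exists K => m nlem.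
  by rewrite ltNge; apply/negP => dm; apply: nm; exists m.
have [m mP] := choice step.
pose K := fix K i := if i is i'.+1 then maxn (K i') (m (K i')).+1 else n.
have KS i : K i.+1 = maxn (K i) (m (K i)).+1 by [].
have Kmono i i' : (i <= i')%N -> (K i <= K i')%N.
  move=> /subnKC <-; elim: (i' - i)%N => [|l IH]; first by rewrite addn0.
  by rewrite addnS KS (leq_trans IH)// leq_maxl.
pose D i := E (m (K i)) `\` \bigcup_(j in [set j | (n <= j < K i)%N]) E j.
have Dlt i i' x : (i < i')%N -> D i x -> ~ D i' x.
  move=> ii' [Ex _] [_]; apply; exists (m (K i)) => //=.
  rewrite (mP (K i)).1 /= (leq_trans _ (Kmono _ _ ii'))// KS.
  exact: leq_maxr.
have Ddisj : trivIset setT D.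
  move=> i i' _ _ [x [Dx D'x]]; case: (ltngtP i i') => // lt.
    by case: (Dlt _ _ _ lt Dx).
  by case: (Dlt _ _ _ lt D'x).
have d2 : 0 < d / 2 by rewrite divr_gt0.
have [g gP] := choice (fun i => opvar_adherent A (D i) d2).
apply: (separable_exhaustive (A := A) (D := D) (g := g) sepX d2 Ddisj) => i.
- by have [] := gP i.
- by have [] := gP i.
- have [_ _] := gP i; have := (mP (K i)).2; rewrite -/(D i).
  by move=> h1 h2; move: (le_lt_trans (lerB h1 (lexx (d / 2))) h2); lra.
Qed.

(** Let H n be a union of finitely many E j with j >= n that exhausts all later
    E m up to a small variation.  Finite intersections of the H n have positive
    variation, so they are not empty; and an ultrafilter that contains H n
    contains one of the finitely many sets that form it. *)
Let ultrafilter_of_large_sets (E : nat -> set nat) (d : R) :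
    separable X -> 0 < d -> (forall m, d <= opvar A (E m)) ->
  exists U : set_system nat, UltraFilter U /\
    forall n, exists j, (n <= j)%N /\ U (E j).
Proof.
move=> sepX d0 dE.
pose eta n := d / 2 ^+ n.+2.
have eta0 n : 0 < eta n by rewrite divr_gt0// exprn_gt0.
have [K KP] := choice (fun n => finite_union_exhausts E n sepX (eta0 n)).
pose H n := \bigcup_(j in [set j | (n <= j < K n)%N]) E j.
pose W n := \bigcap_(i in `I_n) H i.
have WS n : W n.+1 = W n `&` H n by rewrite /W IIS bigcap_setU bigcap_set1.
(* the errors d / 4, d / 8, ... sum to less than d *)
have large k m : (k <= m.+1)%N ->
    d / 2 + d / 2 ^+ k.+1 <= opvar A (E m `&` W k).
  elim: k => [_|k IH km].
    rewrite expr1 /W II0 bigcap_set0 setIT (le_trans _ (dE m))//; lra.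
  have EW : E m `&` W k `<=` (E m `&` W k.+1) `|` (E m `\` H k).
    move=> x [Ex Wx]; have [Hx|Hx] := pselect (H k x); last by right.
    by left; rewrite WS.
  have := opvarS A EW; have := opvarU A (E m `&` W k.+1) (E m `\` H k).
  have := KP k m km; have := IH (ltnW km); rewrite /eta /H !exprS !invfM.
  set p := (2 ^+ k)^-1; lra.
have Wn0 n : W n !=set0.
  apply/set0P/eqP => W0; have := large n n (leqnSn n).
  rewrite W0 setI0; apply/negP; rewrite -ltNge (@le_lt_trans _ _ 0)//.
    apply: opvar_le => g _ g0; suff -> : g = 0 by rewrite linear0 rnorm0.
    by apply: infty_ext => i; exact: g0.
  by rewrite addr_gt0// divr_gt0// exprn_gt0.
pose F := filter_from setT W.
have FF : ProperFilter F.
  apply: filter_from_proper => //; apply: filter_from_filter; first by exists 0.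
  move=> i j _ _; exists (maxn i j) => // x Wx; split=> l /= li; apply: Wx => /=.
    by rewrite (leq_trans li)// leq_maxl.
  by rewrite (leq_trans li)// leq_maxr.
have [U [UU FU]] := ultraFilterLemma FF.
exists U; split=> // n; apply: contrapT => nU.
have UH : U (H n).
  by apply: FU; exists n.+1 => // x; rewrite WS => -[].
suff : forall k, U (~` (\bigcup_(j in [set j | (n <= j < k)%N]) E j)).
  move=> /(_ (K n)) UHc; have U0 : U (H n `&` ~` H n) by exact: filterI.
  by rewrite setICr in U0; exact: (@filter_not_empty _ U _ U0).
elim=> [|k IH].
  apply: (@filterS _ U _ setT); last exact: filterT.
  by move=> x _ [j /=]; rewrite ltn0 andbF.
have [nk|kn] := leqP n k; last first.
  apply: filterS IH => x + [j /= /andP[nj jk] Ex]; apply.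
  by exists j => //=; move: (leq_ltn_trans nj jk); rewrite ltnS leqNgt kn.
have UEc : U (~` E k).
  by have [Ek|//] := in_ultra_setVsetC (E k) UU; case: nU; exists k.
apply: filterS (filterI IH UEc) => x [nx nEx] [j /= /andP[nj]].
rewrite ltnS leq_eqVlt => /predU1P[->//|jk Ex].
by apply: nx; exists j => //=; rewrite nj.
Qed.

(** Where the entries of B (z m) are small, A contributes little; the sets where
    they are large have variation bounded away from zero if the images
    A (B (z m)) do not tend to zero.  An ultrafilter containing infinitely many
    of these sets gives a functional on X, the limit of the entries of B x,
    that does not tend to zero on z. *)
Lemma factor_weakly_null (z : nat -> X) :
    separable X -> (forall m, rnorm (z m) <= 1) -> weakly_null z ->
  forall d : R, 0 < d -> exists N, forall m, (N <= m)%N -> rnorm (A (B (z m))) < d.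
Proof.
move=> sepX z1 z0 d d0; apply: contrapT => nN.
have large_after N : exists m, (N <= m)%N /\ d <= rnorm (A (B (z m))).
  apply: contrapT => ns; apply: nN; exists N => m Nm.
  by rewrite ltNge; apply/negP => dm; apply: ns; exists m.
have [s sP] := choice large_after.
pose a := rnorm A + 1; pose b := rnorm B + 1.
have a0 : 0 < a by rewrite ltr_wpDl// rnorm_ge0.
have b0 : 0 < b by rewrite ltr_wpDl// rnorm_ge0.
have Bz m : rnorm (B (z m)) <= b.
  rewrite (le_trans (le_rnorm_bop _ _))// (@le_trans _ _ (rnorm B))//.
    by rewrite ler_piMr// rnorm_ge0.
  by rewrite lerDl.
pose e := d / 2 / a; have e0 : 0 < e by rewrite !divr_gt0.
pose E m := [set n | e < modulus (B (z (s m)) n)].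
have large m : d / 2 / b <= opvar A (E m).
  rewrite ler_pdivrMr// mulrC; have := (sP m).2.
  rewrite {1}(cutoff_decomp (E m) (B (z (s m)))) linearD => h.
  have small : rnorm (A (cutoff (~` E m) (B (z (s m))))) <= d / 2.
    have eE : d / 2 = a * e by rewrite /e [RHS]mulrC divfK// gt_eqF.
    rewrite (le_trans (le_rnorm_bop _ _))// eE ler_pM// ?rnorm_ge0 ?lerDl//.
    apply: rnorm_infty_le => n; rewrite cutoffE asbool_neg.
    case: asboolP => /= [_|/negP]; first by rewrite modulus0 ltW.
    by rewrite -leNgt.
  have big : rnorm (A (cutoff (E m) (B (z (s m))))) <= b * opvar A (E m).
    rewrite (le_trans (le_opvarZ _ (@cutoff_supported _ _ _)))//.
    by rewrite ler_wpM2r ?opvar_ge0// (le_trans (rnorm_cutoff _ _)).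
  by have := le_trans h (le_trans (rnormD _ _) (lerD big small)); lra.
have db0 : 0 < d / 2 / b by rewrite !divr_gt0.
have [U [UU UE]] := ultrafilter_of_large_sets sepX db0 large.
have Bx x n : modulus (B x n) <= rnorm B * rnorm x.
  by rewrite (le_trans (modulus_le_infty _ _))// le_rnorm_bop.
have [l lP] := choice (fun x => ulim_exists (FU := UU) (Bx x)).
have [k x y|x|psi psil] := @bounded_linear_bop R X R[i]^o l (rnorm B).
- apply: ulim_unique (lP _) _.
  have Blin : (fun n => k * B x n + B y n) = (fun n => B (k *: x + y) n).
    by apply/funext => n; rewrite linearP.
  have lxy : ulim U (fun n => k * B x n + B y n) (k * l x + l y).
    exact: ulim_linear.
  by rewrite Blin in lxy.
- exact: ulim_le (Bx x) (lP x).
have [N NP] := z0 psi _ e0.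
have [j [Nj UEj]] := UE N.
have e2 : 0 < e - modulus (psi (z (s j))).
  by rewrite subr_gt0 NP// (leq_trans Nj)//; case: (sP j).
rewrite psil in e2.
have [n [/= En ln]] := filter_ex (filterI UEj (lP (z (s j)) _ e2)).
have : modulus (B (z (s j)) n) <=
    modulus (B (z (s j)) n - l (z (s j))) + modulus (l (z (s j))).
  by rewrite (le_trans _ (modulusD _ _))// subrK.
by rewrite /E /= in En; lra.
Qed.

End Factorization.

(** * Spaces with very few operators *)

Section VeryFewOperators.
Context {R : realType} (X : normedModType R[i]).
Context (f : bop (dual X) (ell_one R)) (g : bop (ell_one R) (dual X)).
Hypotheses (fK : cancel f g) (few : very_few_operators X).

(** Multiplication by c preserves norms up to the factor |c|, while a compact
    operator makes some vectors of a weakly null sequence of unit vectors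
    arbitrarily small. *)
Lemma scalar_compact_eq0 (c : R[i]) : compact_op (c *: (1 : bop X X)) -> c = 0.
Proof.
move=> cc; apply/eqP; apply: contraT => c0.
have [z [z1 z0]] := weakly_null_unit_sequence fK few.1.
have zle m : rnorm (z m) <= 1 by rewrite z1.
have [m [_]] := compact_op_weakly_null cc zle z0 0 (modulus_gt0 c0).
by rewrite bopZE rnormZ z1 mulr1 ltxx.
Qed.

(** On a weakly null sequence of unit vectors both A B and its compact part come
    close to zero, so the scalar part vanishes. *)
Lemma infty_factor_compact (A : bop (ell_infty R) X) (B : bop X (ell_infty R)) :
  separable X -> compact_op (bop_comp A B).
Proof.
move=> sepX; have [c [S [cS AB]]] := few.2 (bop_comp A B).
suff c0 : c = 0 by rewrite AB c0 scale0r add0r.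
apply/eqP; apply: contraT => c0.
have [z [z1 z0]] := weakly_null_unit_sequence fK few.1.
have zle m : rnorm (z m) <= 1 by rewrite z1.
have d0 : 0 < modulus c / 2 by rewrite divr_gt0// modulus_gt0.
have [N NP] := factor_weakly_null A B sepX zle z0 d0.
have [m [/NP ABm Sm]] := compact_op_weakly_null cS zle z0 N d0.
have cz : c *: z m = A (B (z m)) - S (z m).
  by rewrite -[A _]/(bop_comp A B (z m)) AB bopDE addrK.
suff : modulus c < modulus c by rewrite ltxx.
rewrite {1}(_ : modulus c = rnorm (c *: z m)); last by rewrite rnormZ z1 mulr1.
rewrite cz (le_lt_trans (rnormD _ _))// rnormN [ltRHS]splitr.
exact: ltrD.
Qed.

End VeryFewOperators.

(** * Maps in and out of the second summand *)

Section DirectSumMaps.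
Context {R : realType} (V W : normedModType R[i]).

Lemma bop_inr_exists : exists j : bop W (V * W)%type, forall y, j y = (0, y).
Proof.
have P : (fun y : W => (0 : V, y)) \in @bop_pred R W (V * W)%type.
  apply/asboolP; split=> [k x y|x]; last first.
    by apply: cvg_pair; [exact: cvg_cst|exact: cvg_id].
  by rewrite -[RHS]/(k *: 0 + 0, k *: x + y) scaler0 addr0.
by exists (Bop P).
Qed.

Lemma bop_snd_exists : exists q : bop (V * W)%type W, forall z, q z = z.2.
Proof.
have P : snd \in @bop_pred R (V * W)%type W.
  by apply/asboolP; split=> // x; exact: cvg_snd.
by exists (Bop P).
Qed.

End DirectSumMaps.

Section Interleave.
Context {R : realType}.
Local Notation ell := (ell_infty R).

(** The bounded sequences are isomorphic to their own square: p and q insert a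
    sequence at the even and at the odd places. *)
Lemma infty_interleave : exists p q p' q' : bop ell ell,
  [/\ cancel p p', cancel q q', forall h, p' (q h) = 0 & forall h, q' (p h) = 0].
Proof.
have [||p pE] := @infty_bop R ell (fun n h => if odd n then 0 else h n./2) 1.
- by move=> n k x y; case: ifP => _; rewrite ?mulr0 ?addr0.
- move=> n h; rewrite mul1r.
  by case: ifP; rewrite ?modulus0 ?rnorm_ge0 ?modulus_le_infty.
have [||q qE] := @infty_bop R ell (fun n h => if odd n then h n./2 else 0) 1.
- by move=> n k x y; case: ifP => _; rewrite ?mulr0 ?addr0.
- move=> n h; rewrite mul1r.
  by case: ifP; rewrite ?modulus0 ?rnorm_ge0 ?modulus_le_infty.
have [||p' p'E] := @infty_bop R ell (fun n h => h n.*2) 1.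
- by [].
- by move=> n h; rewrite mul1r modulus_le_infty.
have [||q' q'E] := @infty_bop R ell (fun n h => h n.*2.+1) 1.
- by [].
- by move=> n h; rewrite mul1r modulus_le_infty.
exists p, q, p', q'; split=> h; apply: infty_ext => n.
- by rewrite p'E pE odd_double doubleK.
- by rewrite q'E qE /= odd_double /= uphalf_double.
- by rewrite p'E qE odd_double.
- by rewrite q'E pE /= odd_double.
Qed.

End Interleave.

(** * The ideal of operators with compact top left entry *)

Section MainIdeal.
Context {R : realType} (X : normedModType R[i]).
Context (f : bop (dual X) (ell_one R)) (g : bop (ell_one R) (dual X)).
Hypotheses (fK : cancel f g) (gK : cancel g f).
Hypotheses (few : very_few_operators X) (sepX : separable X).

Local Notation E := (E_sum X).

Lemma entry11D (S T : bop E E) : entry11 (S + T) = entry11 S + entry11 T.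
Proof. exact: bopP. Qed.

Lemma entry11Z k (T : bop E E) : entry11 (k *: T) = k *: entry11 T.
Proof. exact: bopP. Qed.

Lemma entry11_1 : entry11 (1 : bop E E) = 1.
Proof. exact: bopP. Qed.

Lemma K1D (S T : bop E E) : K_1 X S -> K_1 X T -> K_1 X (S + T).
Proof. by rewrite /K_1 /= entry11D; exact: compact_opD. Qed.

Lemma K1Z k (T : bop E E) : K_1 X T -> K_1 X (k *: T).
Proof. by rewrite /K_1 /= entry11Z; exact: compact_opZ. Qed.

(** The product of the off-diagonal entries factors through the bounded
    sequences, so the top left entry is multiplicative modulo compact
    operators. *)
Lemma entry11M (S T : bop E E) : exists2 K, compact_op K &
  entry11 (S * T) = bop_comp (entry11 S) (entry11 T) + K.
Proof.
have [inr inrE] := bop_inr_exists X (ell_infty R).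
have [snd sndE] := bop_snd_exists X (ell_infty R).
exists (bop_comp (bop_comp (bop_fst _ _) (bop_comp S inr))
                 (bop_comp snd (bop_comp T (bop_inl _ _)))).
  exact: (infty_factor_compact fK few).
apply: bopP => x; rewrite bopDE entry11E !bop_compE /= sndE inrE.
rewrite -[RHS]/((S ((T (x, 0)).1, 0) + S (0, (T (x, 0)).2)).1) -linearD.
congr (fst (S _)).
by rewrite [LHS]surjective_pairing -[RHS]/(_ + 0, 0 + _) addr0 add0r.
Qed.

Lemma K1_two_sided : two_sided_ideal (K_1 X).
Proof.
split; first split=> [|S T|S T cT].
- have -> : (0 : bop E E) = 0 *: 0 by rewrite scale0r.
  by rewrite /K_1 /= entry11Z scale0r; exact: compact_op0.
- exact: K1D.
- have [K cK STE] := entry11M S T; rewrite /K_1 /= STE.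
  by apply: compact_opD => //; exact: compact_op_compl.
- move=> S T cS; have [K cK STE] := entry11M S T; rewrite /K_1 /= STE.
  by apply: compact_opD => //; exact: compact_op_compr.
Qed.

Lemma K1_scalar (T : bop E E) : exists c : R[i], K_1 X (T - c *: (1 : bop E E)).
Proof.
have [c [S [cS TE]]] := few.2 (entry11 T); exists c.
rewrite /K_1 /= -scaleN1r entry11D !entry11Z entry11_1 TE scaleN1r.
by rewrite addrAC subrr add0r.
Qed.

Lemma K1_scalar_eq0 (c : R[i]) : K_1 X (c *: (1 : bop E E)) -> c = 0.
Proof.
by rewrite /K_1 /= entry11Z entry11_1; exact: (scalar_compact_eq0 fK few).
Qed.

Lemma K1_proper : K_1 X <> setT.
Proof.
move=> K1T; have : K_1 X (1 *: (1 : bop E E)) by rewrite K1T.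
by move/K1_scalar_eq0/eqP; rewrite oner_eq0.
Qed.

Lemma K1_codim1 : has_codim 1 (K_1 X).
Proof.
exists (fun=> 1 : bop E E) => T; have [c cT] := K1_scalar T.
exists (fun=> c); split=> [|c' c'T]; first by rewrite big_ord1.
apply/funext => i; rewrite (ord1 i); move: c'T; rewrite big_ord1 => c'T.
apply/eqP; rewrite -subr_eq0; apply/eqP/K1_scalar_eq0.
have -> : (c - c' ord0) *: (1 : bop E E) =
    (T - c' ord0 *: (1 : bop E E)) + (-1) *: (T - c *: (1 : bop E E)).
  by rewrite scaleN1r opprB [RHS]addrC addrA subrK scalerBl.
exact: (K1D c'T (K1Z (-1) cT)).
Qed.

(** A member of J outside K_1 is a nonzero scalar modulo K_1, so J contains the
    identity. *)
Lemma K1_left_maximal (J : set (bop E E)) : left_ideal J -> K_1 X `<=` J ->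
  J = K_1 X \/ J = setT.
Proof.
move=> [_ JD JM] KJ.
have [JK|nJK] := pselect (J `<=` K_1 X); first by left; apply/seteqP.
right; have [T JT nKT] : exists2 T, J T & ~ K_1 X T.
  apply: contrapT => nT; apply: nJK => T JT; apply: contrapT => nKT.
  by apply: nT; exists T.
have [c cT] := K1_scalar T.
have c0 : c != 0.
  by apply/eqP => c0; apply: nKT; move: cT; rewrite c0 scale0r subr0.
suff J1 : J 1 by apply/seteqP; split=> // S _; rewrite -[S]mulr1; exact: JM.
have -> : 1 = (c^-1 *: (1 : bop E E)) * (T + (-1) * (T - c *: (1 : bop E E))).
  rewrite mulN1r opprB addrCA subrr addr0 -bop_scalerAl mul1r scalerA mulVf//.
  by rewrite scale1r.
exact: JM (JD _ _ JT (JM _ _ (KJ _ cT))).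
Qed.

(** The generator sends (x, h) to (0, k), where k interleaves the coordinates
    of x with h.  Composing with an operator on the second summand recovers
    the second column of T directly and the first column by extension along
    the coordinate embedding. *)
Lemma K1_generator : exists t : bop E E,
  (forall z, t z = 0 -> z = 0) /\ K_1 X = [set s * t | s in [set: bop E E]].
Proof.
have [inr inrE] := bop_inr_exists X (ell_infty R).
have [snd sndE] := bop_snd_exists X (ell_infty R).
have [U UE] := coordinates_exists g.
have [p [q [p' [q' [pK qK pq qp]]]]] := @infty_interleave R.
pose t : bop E E :=
  bop_comp inr (bop_comp p (bop_comp U (bop_fst _ _)) + bop_comp q snd).
have tE z : t z = (0, p (U z.1) + q z.2).
  by rewrite /t !bop_compE inrE bopDE !bop_compE sndE.
have decp x h : p' (p (U x) + q h) = U x by rewrite linearD /= pK pq addr0.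
have decq x h : q' (p (U x) + q h) = h by rewrite linearD /= qK qp add0r.
have tK : K_1 X t.
  rewrite /K_1 /=; have -> : entry11 t = 0 by apply: bopP => x; rewrite entry11E tE.
  exact: compact_op0.
exists t; split=> [[x h]|].
  rewrite tE => /(congr1 (fun z : E => z.2)) e0.
  have {}e0 : p (U x) + q h = 0 by exact: e0.
  have Ux0 : U x = U 0 by rewrite -(decp x h) e0 !linear0.
  have h0 : h = 0 by rewrite -(decq x h) e0 linear0.
  congr (_, _); last exact: h0.
  by apply: (unit_dual_total fK) => n; rewrite -!UE Ux0.
apply/seteqP; split=> [T TK|_ [s _ <-]]; last first.
  by have [[_ _ KM] _] := K1_two_sided; exact: KM.
have [S1 S1E] := extension_compact fK gK UE TK.
have [S2 S2E] := extension_infty fK gK (bop_comp snd (bop_comp T (bop_inl _ _))) UE.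
pose s : bop E E := bop_comp (bop_inl _ _) (bop_comp S1 (bop_comp p' snd))
  + bop_comp inr (bop_comp S2 (bop_comp p' snd))
  + bop_comp T (bop_comp inr (bop_comp q' snd)).
exists s => //; apply: bopP => -[x h]; rewrite bopM tE.
have sE y : s (0, y) = (S1 (p' y), 0) + (0, S2 (p' y)) + T (0, q' y).
  by rewrite /s !bopDE !bop_compE sndE !inrE.
rewrite sE decp decq S1E S2E entry11E bop_compE sndE bop_compE.
rewrite -[bop_inl _ _ x]/(x, 0).
have -> : ((T (x, 0)).1, 0) + (0, (T (x, 0)).2) = T (x, 0).
  by rewrite [RHS]surjective_pairing -[LHS]/(_ + 0, 0 + _) addr0 add0r.
by rewrite -linearD -[(x, 0) + _]/(x + 0, 0 + h) addr0 add0r.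
Qed.

Lemma K1_not_fixed : ~ fixed_left_ideal (K_1 X).
Proof.
move=> [x x0 KE]; have [t [tinj tE]] := K1_generator.
suff /tinj : t x = 0 by apply/eqP.
have : K_1 X t by rewrite tE; exists 1 => //; rewrite mul1r.
by rewrite KE.
Qed.

End MainIdeal.

Theorem theorem1p5 (R : realType) (X : completeNormedModType R[i])
  (few : very_few_operators X)
  (basis : has_schauder_basis X)
  (dual_ell_one : isomorphic (dual X) (ell_one R)) :
  [/\ maximal_two_sided_ideal (K_1 X),
      has_codim 1 (K_1 X),
      maximal_left_ideal (K_1 X),
      singly_generated_left_ideal (K_1 X)
    & ~ fixed_left_ideal (K_1 X)].
Proof.
have [f [g [fK gK]]] := dual_ell_one.
have sepX := schauder_basis_separable basis.
have two := K1_two_sided fK few sepX.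
have proper := K1_proper fK few.
split.
- by split=> // J [lJ _] KJ; apply: (K1_left_maximal few lJ KJ).
- exact: K1_codim1 fK few.
- by split=> // [|J lJ]; [case: two|move=> KJ; apply: (K1_left_maximal few lJ KJ)].
- by have [t [_ tE]] := K1_generator fK gK few sepX; exists t.
- exact: K1_not_fixed fK gK few sepX.
Qed.
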